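(* Let $\Delta\ge3$ be an integer. Suppose $k>\Delta$ is an integer and $0<\varepsilon<1$ are such that there exists a constant $0<K<1/(\Delta-1)$ with $\theta:=\arcsin(K)\in\big(0,\frac{\pi}{3(\Delta-1+\varepsilon)}\big)$ such that for each $d=0,\dots,\Delta-1$, with $b=\Delta-d$, \[0<\frac{(1+\varepsilon)^2}{(k-b)(1-K)^d-\varepsilon b}\le K.\] Let $G=(V,E)$ be any graph of maximum degree at most $\Delta$ and $(w_e)_{e\in E}$ complex weights such that for each $e\in E$ either (i) $|w_e|\le\varepsilon$, or (ii) $|\arg(w_e)|\le\varepsilon\theta$ and $\varepsilon<|w_e|\le1$. Write $\mathbf{Z}^W_L(G)$ for the restricted partition function with $k$ colours and these weights. Then: (A) For every list $W$ of distinct vertices forming a leaf-independent set in $G$ and every list $L$ of colours with $|L|=|W|$, $\mathbf{Z}^W_L(G)\ne0$. (B) For every list $W=W'u$ of distinct vertices forming a leaf-independent set, and any two colour lists $L'\ell$ and $L'\ell'$ of length $|W|$: (i) the angle between $\mathbf{Z}^{W'u}_{L'\ell}(G)$ and $\mathbf{Z}^{W'u}_{L'\ell'}(G)$ is at most $\theta$; (ii) $\mathbf{Z}^{W'u}_{L'\ell}(G)/\mathbf{Z}^{W'u}_{L'\ell'}(G)\in B(1,K)$. (C) For every list $W=W'u$ of distinct vertices such that $W'$ forms a leaf-independent set in $G$, and every colour list $L'$ of length $|W'|$: let $\mathcal{G}$ and $\mathcal{N}$ be the sets of good and neutral colours for $u$ with respect to $(G,W',L',\varepsilon)$, let $d$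 be the number of free neighbours of $u$ (neighbours not in $W'$) and $b=\Delta-d$. Then (i) $\mathbf{Z}^{W'u}_{L'\ell}(G)\neq0$ for every $\ell\in\mathcal{G}\cup\mathcal{N}$; (ii) for all $\ell,\ell'\in\mathcal{G}\cup\mathcal{N}$ the angle between $\mathbf{Z}^{W'u}_{L'\ell}(G)$ and $\mathbf{Z}^{W'u}_{L'\ell'}(G)$ is at most $(d+b\varepsilon)\theta$; (iii) for all $\ell,j\in\mathcal{G}$, $\mathbf{Z}^{W'u}_{L'\ell}(G)/\mathbf{Z}^{W'u}_{L'j}(G)\in B(1,K)^d$.
   Context: Graphs are simple; $[k]=\{1,\dots,k\}$. For a graph $G=(V,E)$ with complex edge weights $(w_e)$, a list $W=w_1\dots w_m$ of distinct vertices and a list $L=\ell_1\dots\ell_m$ of colours in $[k]$, the restricted partition function is \[\mathbf{Z}^W_L(G)=\sum_{\phi:V\to[k],\ \phi(w_i)=\ell_i\ \forall i}\ \prod_{uv\in E,\ \phi(u)=\phi(v)} w_{uv}.\] $W'u$ and $L'\ell$ denote concatenation of lists. Vertices in $W$ are called fixed (with colour given by $L$); other vertices are free. A set $W\subseteq V$ is leaf-independent if it is an independent set and every vertex in $W$ has degree exactly $1$. Given $\varepsilon>0$, a neighbour $v$ of $u$ is a bad neighbour if $|w_{uv}|\le\varepsilon$. A colour $\ell$ is good for $u$ if no fixed neighbour of $u$ has colour $\ell$; bad if $u$ has at least one fixed bad neighbour coloured $\ell$; neutral if neither good nor bad. Angles between non-zero complex numbers are taken in $[0,\pi]$. $B(a,r)$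 is the open disk of radius $r$ centred at $a$, and $B(a,r)^d=\{b_1\cdots b_d: b_i\in B(a,r)\}$. *)

(* Defs.v *)
From Stdlib Require Import Reals Lra Lia List Arith Bool.
Import ListNotations.
Open Scope R_scope.

Record Cx := mkC { Re : R; Im : R }.
Definition Czero : Cx := mkC 0 0.
Definition Cone : Cx := mkC 1 0.
Definition Cadd (z w : Cx) : Cx := mkC (Re z + Re w) (Im z + Im w).
Definition Csub (z w : Cx) : Cx := mkC (Re z - Re w) (Im z - Im w).
Definition Cmul (z w : Cx) : Cx :=
  mkC (Re z * Re w - Im z * Im w) (Re z * Im w + Im z * Re w).
Definition Cnorm2 (z : Cx) : R := Re z * Re z + Im z * Im z.
Definition Cnorm (z : Cx) : R := sqrt (Cnorm2 z).
Definition Cinv (z : Cx) : Cx := mkC (Re z / Cnorm2 z) (- Im z / Cnorm2 z).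
Definition Cdiv (z w : Cx) : Cx := Cmul z (Cinv w).

Definition Cangle (z w : Cx) : R :=
  acos ((Re z * Re w + Im z * Im w) / (Cnorm z * Cnorm w)).

(* |arg w| for w <> 0 (principal argument in (-pi, pi]) = angle between w and 1 *)
Definition abs_arg (w : Cx) : R := Cangle w Cone.

Definition in_ball (a : Cx) (r : R) (z : Cx) : Prop := Cnorm (Csub z a) < r.
Definition Cprod (zs : list Cx) : Cx := fold_right Cmul Cone zs.
Definition in_ball_pow (a : Cx) (r : R) (d : nat) (z : Cx) : Prop :=
  exists zs : list Cx, length zs = d /\ Forall (in_ball a r) zs /\ z = Cprod zs.

(* A simple graph on vertex set {0,...,n-1}: adjacency relation adj,
   symmetric and irreflexive. Edge weights w u v, symmetric. *)
Definition simple_graph (n : nat) (adj : nat -> nat -> bool) : Prop :=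
  (forall u v, adj u v = adj v u) /\ (forall u, adj u u = false) /\
  (forall u v, adj u v = true -> (u < n)%nat /\ (v < n)%nat).

Definition neighbours (n : nat) (adj : nat -> nat -> bool) (u : nat) : list nat :=
  filter (fun v => adj u v) (seq 0 n).
Definition degree (n : nat) (adj : nat -> nat -> bool) (u : nat) : nat :=
  length (neighbours n adj u).
Definition max_degree_le (n : nat) (adj : nat -> nat -> bool) (D : nat) : Prop :=
  forall u, (u < n)%nat -> (degree n adj u <= D)%nat.

Definition edges (n : nat) (adj : nat -> nat -> bool) : list (nat * nat) :=
  flat_map (fun u => map (fun v => (u, v)) (filter (fun v => Nat.ltb u v && adj u v) (seq 0 n)))
           (seq 0 n).

(* all colourings phi : {0..n-1} -> [k] = {1..k}, encoded as lists of length n *)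
Fixpoint colourings (n k : nat) : list (list nat) :=
  match n with
  | O => [[]]
  | S m => flat_map (fun c => map (fun l => l :: c) (seq 1 k)) (colourings m k)
  end.
(* colouring c encodes phi with vertex i |-> nth i c 0; note the list is built
   so that the head corresponds to vertex 0 only up to reversal; we use rev *)
Definition col (c : list nat) (i : nat) : nat := nth i (rev c) 0%nat.

Definition respects (c : list nat) (W L : list nat) : bool :=
  forallb (fun p => Nat.eqb (col c (fst p)) (snd p)) (combine W L).

Definition weight (n : nat) (adj : nat -> nat -> bool) (w : nat -> nat -> Cx)
  (c : list nat) : Cx :=
  fold_right (fun e acc =>
     if Nat.eqb (col c (fst e)) (col c (snd e)) then Cmul (w (fst e) (snd e)) acc else acc)
    Cone (edges n adj).

Definition Zpart (k n : nat) (adj : nat -> nat -> bool) (w : nat -> nat -> Cx)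
  (W L : list nat) : Cx :=
  fold_right (fun c acc => if respects c W L then Cadd (weight n adj w c) acc else acc)
    Czero (colourings n k).

Definition leaf_independent (n : nat) (adj : nat -> nat -> bool) (W : list nat) : Prop :=
  (forall x, In x W -> (x < n)%nat /\ degree n adj x = 1%nat) /\
  (forall x y, In x W -> In y W -> adj x y = false).

Definition colour_list (k : nat) (L : list nat) : Prop :=
  Forall (fun l => (1 <= l <= k)%nat) L.

Definition good_colour (adj : nat -> nat -> bool) (W L : list nat) (u l : nat) : Prop :=
  ~ (exists i, (i < length W)%nat /\ adj u (nth i W 0%nat) = true /\ nth i L 0%nat = l).
Definition bad_colour (eps : R) (adj : nat -> nat -> bool) (w : nat -> nat -> Cx)
  (W L : list nat) (u l : nat) : Prop :=
  exists i, (i < length W)%nat /\ adj u (nth i W 0%nat) = true /\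
            Cnorm (w u (nth i W 0%nat)) <= eps /\ nth i L 0%nat = l.
Definition neutral_colour eps adj w W L u l : Prop :=
  ~ good_colour adj W L u l /\ ~ bad_colour eps adj w W L u l.

Definition free_degree (n : nat) (adj : nat -> nat -> bool) (W : list nat) (u : nat) : nat :=
  length (filter (fun v => negb (existsb (Nat.eqb v) W)) (neighbours n adj u)).

(* Main.v *)
(* Deleting a fixed leaf leaves behind, at its neighbour, only a weight and a
   colour; so a graph with fixed leaves is a set of free vertices carrying lists
   of such pendants, and the same list also absorbs the edges of a vertex [u]
   that gets fixed. This makes (C) for [u] a statement about recolouring the [d]
   pendants created at the free neighbours of [u] one at a time, each step being
   an instance of (B).

   For (B) and (A), sum over the colour [j] of the vertex [u] carrying the
   pendant. With [Y j] the contribution without the pendants at [u], all ratios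
   [Y j / Y M] lie in [B(1, K)^d], hence have real part at least [(1 - K)^d]; a
   good colour contributes at least that much, a neutral one has nonnegative
   real part, and a bad one at least [- eps]. Choosing [M] to maximise [|Y M|]
   bounds the sum below by [((k - b) (1 - K)^d - eps b) |Y M|], whereas
   recolouring a pendant changes it by at most [(1 + eps)^2 |Y M|]. *)

From Coquelicot Require Import Hierarchy Derive AutoDerive.
Require Import Defs.
From Stdlib Require Import Reals Lra Lia List Arith Bool Permutation.
Import ListNotations.
Open Scope R_scope.

(** The threshold [PI / 3] comes from differences: two complex numbers at an angle of at most
    [PI / 3] differ by no more than the larger modulus. The largest angle to be kept below it is
    [(D - 1 + eps) theta], from [D - 1] free neighbours and one pendant. In [(1 + eps)^2], one
    factor bounds [|x - 1|] for the weight [x] of the recoloured pendant; the other bounds the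
    difference between the terms of the two colours, and its [eps] is spent only if one of these
    colours is bad.

    Two gaps separate the numerical condition from this argument. It bounds a quotient by [<= K],
    while the disk is open; and it is silent for [d = D], where [u] has no pendants and every term
    has positive real part after normalisation.

    The hardest estimate is that a product of [d] elements of [B(1, K)] has real part at least
    [(1 - K)^d], since moduli and arguments of the factors vary independently. Log-concavity of the
    cosine reduces it to [d] equal factors, and then it is a one-variable problem along the near arc
    of the disk. *)

Lemma Cx_eq (z z' : Cx) : Re z = Re z' -> Im z = Im z' -> z = z'.
Proof. destruct z, z'; simpl; intros -> ->; reflexivity. Qed.

Lemma Rabs_le_bounds (x a : R) : Rabs x <= a -> - a <= x <= a.
Proof. unfold Rabs; destruct (Rcase_abs x); lra. Qed.

(** * Complex arithmetic and the modulus *)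

Definition Copp (z : Cx) : Cx := mkC (- Re z) (- Im z).

Lemma Cx_ring_theory : ring_theory Czero Cone Cadd Cmul Csub Copp eq.
Proof.
  constructor; intros; apply Cx_eq; simpl; ring.
Qed.
Add Ring Cx_ring : Cx_ring_theory.

Lemma Cnorm2_nonneg (z : Cx) : 0 <= Cnorm2 z.
Proof. unfold Cnorm2; nra. Qed.

Lemma Cnorm_nonneg (z : Cx) : 0 <= Cnorm z.
Proof. apply sqrt_pos. Qed.

Lemma Cnorm_sqr (z : Cx) : Cnorm z * Cnorm z = Cnorm2 z.
Proof. apply sqrt_sqrt, Cnorm2_nonneg. Qed.

Lemma Cnorm2_mul (z z' : Cx) : Cnorm2 (Cmul z z') = Cnorm2 z * Cnorm2 z'.
Proof. unfold Cnorm2; simpl; ring. Qed.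

Lemma Cnorm_mul (z z' : Cx) : Cnorm (Cmul z z') = Cnorm z * Cnorm z'.
Proof.
  unfold Cnorm; rewrite Cnorm2_mul; apply sqrt_mult; apply Cnorm2_nonneg.
Qed.

Lemma Cnorm_one : Cnorm Cone = 1.
Proof.
  unfold Cnorm, Cnorm2; simpl.
  replace (1 * 1 + 0 * 0) with 1 by ring; apply sqrt_1.
Qed.

Lemma Cnorm2_eq0 (z : Cx) : Cnorm2 z = 0 -> z = Czero.
Proof.
  unfold Cnorm2; intros H; apply Cx_eq; simpl; nra.
Qed.

Lemma Cnorm_eq0 (z : Cx) : Cnorm z = 0 -> z = Czero.
Proof.
  intros H; apply Cnorm2_eq0; rewrite <- Cnorm_sqr, H; ring.
Qed.

Lemma Cnorm_pos (z : Cx) : z <> Czero -> 0 < Cnorm z.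
Proof.
  intros H; destruct (Cnorm_nonneg z) as [?|E]; [assumption|].
  now elim H; apply Cnorm_eq0.
Qed.

Lemma Cnorm_zero : Cnorm Czero = 0.
Proof.
  unfold Cnorm, Cnorm2; simpl.
  replace (0 * 0 + 0 * 0) with 0 by ring; apply sqrt_0.
Qed.

Lemma Cnorm_le_sqr (z : Cx) (a : R) : 0 <= a -> Cnorm2 z <= a * a -> Cnorm z <= a.
Proof.
  intros Ha H; pose proof (Cnorm_nonneg z); rewrite <- Cnorm_sqr in H; nra.
Qed.

Lemma Cnorm_lt_sqr (z : Cx) (a : R) : 0 <= a -> Cnorm2 z < a * a -> Cnorm z < a.
Proof.
  intros Ha H; pose proof (Cnorm_nonneg z); rewrite <- Cnorm_sqr in H; nra.
Qed.

Lemma Cnorm_add (z z' : Cx) : Cnorm (Cadd z z') <= Cnorm z + Cnorm z'.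
Proof.
  pose proof (Cnorm_nonneg z); pose proof (Cnorm_nonneg z').
  assert (Hd : Re z * Re z' + Im z * Im z' <= Cnorm z * Cnorm z').
  { rewrite <- Cnorm_mul.
    destruct (Rle_lt_dec (Re z * Re z' + Im z * Im z') 0) as [Hn|Hp].
    - pose proof (Cnorm_nonneg (Cmul z z')); lra.
    - pose proof (Cnorm_nonneg (Cmul z z')) as H1.
      pose proof (Cnorm_sqr (Cmul z z')) as H2.
      rewrite Cnorm2_mul in H2; unfold Cnorm2 in H2.
      pose proof (Rle_0_sqr (Re z * Im z' - Im z * Re z')); unfold Rsqr in *.
      apply Rsqr_incr_0_var; unfold Rsqr; nra. }
  apply Cnorm_le_sqr; [lra|].
  pose proof (Cnorm_sqr z) as H1; pose proof (Cnorm_sqr z') as H2.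
  unfold Cnorm2 in *; simpl; nra.
Qed.

Lemma Cnorm_sub (z z' : Cx) : Cnorm (Csub z z') <= Cnorm z + Cnorm z'.
Proof.
  replace (Csub z z') with (Cadd z (Copp z')) by ring.
  replace (Cnorm z') with (Cnorm (Copp z')); [apply Cnorm_add|].
  unfold Cnorm, Cnorm2; simpl; f_equal; ring.
Qed.

Lemma Re_le_Cnorm (z : Cx) : Rabs (Re z) <= Cnorm z.
Proof.
  apply Rsqr_incr_0_var; [|apply Cnorm_nonneg].
  unfold Rsqr; rewrite Cnorm_sqr, <- Rabs_mult, Rabs_pos_eq by nra.
  unfold Cnorm2; nra.
Qed.

Lemma Cdiv_eq (z z' q : Cx) : z' <> Czero -> z = Cmul q z' -> Cdiv z z' = q.
Proof.
  intros Hz ->.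
  assert (Cnorm2 z' <> 0) by (intros E; now apply Hz, Cnorm2_eq0).
  unfold Cdiv; apply Cx_eq; simpl; unfold Cnorm2 in *; field; assumption.
Qed.

Lemma Cdiv_mul (z z' : Cx) : z' <> Czero -> z = Cmul (Cdiv z z') z'.
Proof.
  intros Hz.
  assert (Cnorm2 z' <> 0) by (intros E; now apply Hz, Cnorm2_eq0).
  unfold Cdiv; apply Cx_eq; simpl; unfold Cnorm2 in *; field; assumption.
Qed.

Lemma Cmul_neq0 (z z' : Cx) : z <> Czero -> z' <> Czero -> Cmul z z' <> Czero.
Proof.
  intros Hz Hz' E.
  apply Cnorm_pos in Hz; apply Cnorm_pos in Hz'.
  assert (Cnorm (Cmul z z') = 0) by (rewrite E; apply Cnorm_zero).
  rewrite Cnorm_mul in *; nra.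
Qed.

(** * Polar form *)

Definition cis (r t : R) : Cx := mkC (r * cos t) (r * sin t).

Lemma cis_mul (r t r' t' : R) : Cmul (cis r t) (cis r' t') = cis (r * r') (t + t').
Proof.
  unfold cis; apply Cx_eq; simpl; [rewrite cos_plus|rewrite sin_plus]; ring.
Qed.

Lemma Cnorm2_cis (r t : R) : Cnorm2 (cis r t) = r * r.
Proof.
  unfold Cnorm2, cis; simpl.
  pose proof (sin2_cos2 t); unfold Rsqr in *.
  transitivity (r * r * (sin t * sin t + cos t * cos t)); [ring|].
  rewrite H; ring.
Qed.

Lemma Cnorm_cis (r t : R) : 0 <= r -> Cnorm (cis r t) = r.
Proof.
  intros Hr; unfold Cnorm; rewrite Cnorm2_cis; now apply sqrt_square.
Qed.

(** [t] is a real number, not an angle modulo [2 PI], so apertures add under multiplication with no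
    case of wrap-around. Positive [r] keeps 0 out. *)
Definition sector (a : R) (z : Cx) : Prop :=
  exists r t : R, 0 < r /\ Rabs t <= a /\ z = cis r t.

Lemma sector_neq0 (a : R) (z : Cx) : sector a z -> z <> Czero.
Proof.
  intros (r & t & Hr & _ & ->) E.
  assert (H : Cnorm (cis r t) = 0) by (rewrite E; apply Cnorm_zero).
  rewrite Cnorm_cis in H; lra.
Qed.

Lemma sector_le (a a' : R) (z : Cx) : a <= a' -> sector a z -> sector a' z.
Proof.
  intros H (r & t & Hr & Ht & E); exists r, t; repeat split; auto; lra.
Qed.

Lemma sector_one (a : R) : 0 <= a -> sector a Cone.
Proof.
  intros Ha; exists 1, 0; repeat split; [lra|rewrite Rabs_R0; lra|].
  unfold cis; rewrite cos_0, sin_0; apply Cx_eq; simpl; ring.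
Qed.

Lemma sector_mul (a a' : R) (z z' : Cx) :
  sector a z -> sector a' z' -> sector (a + a') (Cmul z z').
Proof.
  intros (r & t & Hr & Ht & ->) (r' & t' & Hr' & Ht' & ->).
  exists (r * r'), (t + t'); repeat split.
  - now apply Rmult_lt_0_compat.
  - pose proof (Rabs_triang t t'); lra.
  - apply cis_mul.
Qed.

Lemma sector_quotient (a a' : R) (z z' : Cx) :
  sector a z -> sector a' z' ->
  exists q, sector (a + a') q /\ z = Cmul q z'.
Proof.
  intros Hz (r' & t' & Hr' & Ht' & ->).
  exists (Cmul z (cis (/ r') (- t'))); split.
  - apply sector_mul; [assumption|].
    exists (/ r'), (- t'); repeat split.
    + now apply Rinv_0_lt_compat.
    + now rewrite Rabs_Ropp.
  - transitivity (Cmul z (Cmul (cis (/ r') (- t')) (cis r' t'))); [|ring].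
    rewrite cis_mul.
    replace (/ r' * r') with 1 by (field; lra).
    replace (- t' + t') with 0 by ring.
    unfold cis; rewrite cos_0, sin_0; apply Cx_eq; simpl; ring.
Qed.

Lemma cos_Rabs (t : R) : cos (Rabs t) = cos t.
Proof.
  unfold Rabs; destruct (Rcase_abs t); [apply cos_neg|reflexivity].
Qed.

Lemma cos_le_Rabs (t a : R) : Rabs t <= a -> a <= PI -> cos a <= cos t.
Proof.
  intros H1 H2; rewrite <- (cos_Rabs t).
  pose proof (Rabs_pos t); apply cos_decr_1; lra.
Qed.

Lemma sector_Re_nonneg (a : R) (z : Cx) : a <= PI / 2 -> sector a z -> 0 <= Re z.
Proof.
  intros Ha (r & t & Hr & Ht & ->); simpl.
  apply Rmult_le_pos; [lra|].
  rewrite <- cos_PI2; apply cos_le_Rabs; [lra|pose proof PI_RGT_0; lra].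
Qed.

Lemma sector_Re_pos (a : R) (z : Cx) : a < PI / 2 -> sector a z -> 0 < Re z.
Proof.
  intros Ha (r & t & Hr & Ht & ->); simpl.
  apply Rmult_lt_0_compat; [lra|].
  apply Rabs_le_bounds in Ht.
  apply cos_gt_0; lra.
Qed.

(** Multiplication by [cis r t] turns [z] by [t], and the quotient under [acos] becomes [cos t]. If
    [|t|] exceeds [PI], so does [a], while [acos] never does. *)
Lemma Cangle_le_sector (a : R) (z q : Cx) :
  z <> Czero -> sector a q -> Cangle (Cmul q z) z <= a.
Proof.
  intros Hz (r & t & Hr & Ht & ->).
  pose proof (Cnorm_pos z Hz) as Hp.
  unfold Cangle; rewrite Cnorm_mul, Cnorm_cis by lra.
  replace ((Re (Cmul (cis r t) z) * Re z + Im (Cmul (cis r t) z) * Im z) /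
           (r * Cnorm z * Cnorm z)) with (cos t).
  2: { replace (r * Cnorm z * Cnorm z) with (r * Cnorm2 z)
         by (rewrite <- Cnorm_sqr; ring).
       assert (Cnorm2 z <> 0) by (rewrite <- Cnorm_sqr; nra).
       simpl; unfold Cnorm2 in *; field; split; lra. }
  destruct (Rle_dec (Rabs t) PI) as [Hle|Hgt].
  - rewrite <- cos_Rabs, acos_cos; [assumption|].
    split; [apply Rabs_pos|assumption].
  - pose proof (acos_bound (cos t)); lra.
Qed.

(** [acos] yields only the absolute value of the argument; its sign is recovered from that of
    [Im z]. *)
Lemma abs_arg_sector (a : R) (z : Cx) :
  z <> Czero -> abs_arg z <= a -> sector a z.
Proof.
  intros Hz; pose proof (Cnorm_pos z Hz) as Hp.
  unfold abs_arg, Cangle; rewrite Cnorm_one; simpl.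
  replace ((Re z * 1 + Im z * 0) / (Cnorm z * 1)) with (Re z / Cnorm z) by (field; lra).
  intros Ha.
  assert (Hb : -1 <= Re z / Cnorm z <= 1).
  { pose proof (Re_le_Cnorm z) as H; apply Rabs_le_bounds in H.
    split; [apply Rmult_le_reg_r with (Cnorm z)|apply Rmult_le_reg_r with (Cnorm z)];
      try assumption; unfold Rdiv; rewrite Rmult_assoc, Rinv_l by lra; lra. }
  pose proof (acos_bound (Re z / Cnorm z)) as Hac.
  assert (Hs : sqrt (1 - Rsqr (Re z / Cnorm z)) = Rabs (Im z) / Cnorm z).
  { replace (1 - Rsqr (Re z / Cnorm z)) with (Rsqr (Rabs (Im z) / Cnorm z)).
    - apply sqrt_Rsqr; apply Rle_mult_inv_pos; [apply Rabs_pos|assumption].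
    - rewrite !Rsqr_div', <- Rsqr_abs; unfold Rsqr; rewrite Cnorm_sqr.
      assert (Cnorm2 z <> 0) by (rewrite <- Cnorm_sqr; nra).
      unfold Cnorm2 in *; field; assumption. }
  destruct (Rle_lt_dec 0 (Im z)) as [Hi|Hi].
  - exists (Cnorm z), (acos (Re z / Cnorm z)); repeat split; auto.
    + rewrite Rabs_pos_eq; lra.
    + unfold cis; rewrite cos_acos, sin_acos, Hs by assumption.
      rewrite Rabs_pos_eq by assumption; apply Cx_eq; simpl; field; lra.
  - exists (Cnorm z), (- acos (Re z / Cnorm z)); repeat split; auto.
    + rewrite Rabs_Ropp, Rabs_pos_eq; lra.
    + unfold cis; rewrite cos_neg, sin_neg, cos_acos, sin_acos, Hs by assumption.
      rewrite Rabs_left by assumption; apply Cx_eq; simpl; field; lra.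
Qed.

(** * Differences of complex numbers at an angle of at most [PI / 3] *)

Lemma sq_sub_add_one_mul_le (r x m : R) :
  0 < r -> 0 <= x -> x <= m -> r * x <= m -> (r * r - r + 1) * (x * x) <= m * m.
Proof.
  intros Hr Hx Hm Hrm.
  assert (x * x <= m * m) by nra.
  assert ((r * x) * (r * x) <= m * m) by (assert (0 <= r * x) by nra; nra).
  assert (0 <= x * x) by nra.
  destruct (Rle_dec r 1); [|nra].
  assert (r * r - r + 1 <= 1) by nra; nra.
Qed.

(** The law of cosines with [cos t >= 1 / 2]: the side of a triangle opposite an angle of at most
    [PI / 3] is no longer than the longer of the other two. *)
Lemma Csub_sector_le (z q : Cx) (a m : R) :
  a <= PI / 3 -> sector a q -> Cnorm z <= m -> Cnorm (Cmul q z) <= m ->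
  Cnorm (Csub (Cmul q z) z) <= m.
Proof.
  intros Ha (r & t & Hr & Ht & ->) Hm Hqm.
  assert (Hc : 1 / 2 <= cos t).
  { rewrite <- cos_PI3; apply cos_le_Rabs; pose proof PI_RGT_0; lra. }
  rewrite Cnorm_mul, Cnorm_cis in Hqm by lra.
  pose proof (Cnorm_nonneg z) as Hz.
  apply Cnorm_le_sqr; [lra|].
  replace (Csub (Cmul (cis r t) z) z) with (Cmul (Csub (cis r t) Cone) z) by ring.
  rewrite Cnorm2_mul, <- (Cnorm_sqr z).
  replace (Cnorm2 (Csub (cis r t) Cone)) with (Cnorm2 (cis r t) - 2 * r * cos t + 1)
    by (unfold Cnorm2, cis; simpl; ring).
  rewrite Cnorm2_cis.
  apply Rle_trans with ((r * r - r + 1) * (Cnorm z * Cnorm z)).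
  - apply Rmult_le_compat_r; nra.
  - apply sq_sub_add_one_mul_le; lra.
Qed.

Lemma Csub_sector_lt (z q : Cx) (a m : R) :
  z <> Czero -> a < PI / 3 -> sector a q -> Cnorm z <= m -> Cnorm (Cmul q z) <= m ->
  Cnorm (Csub (Cmul q z) z) < m.
Proof.
  intros Hz0 Ha (r & t & Hr & Ht & ->) Hm Hqm.
  assert (Hc : 1 / 2 < cos t).
  { rewrite <- cos_PI3, <- (cos_Rabs t).
    pose proof PI_RGT_0; pose proof (Rabs_pos t); apply cos_decreasing_1; lra. }
  rewrite Cnorm_mul, Cnorm_cis in Hqm by lra.
  pose proof (Cnorm_pos z Hz0) as Hz.
  apply Cnorm_lt_sqr; [lra|].
  replace (Csub (Cmul (cis r t) z) z) with (Cmul (Csub (cis r t) Cone) z) by ring.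
  rewrite Cnorm2_mul, <- (Cnorm_sqr z).
  replace (Cnorm2 (Csub (cis r t) Cone)) with (Cnorm2 (cis r t) - 2 * r * cos t + 1)
    by (unfold Cnorm2, cis; simpl; ring).
  rewrite Cnorm2_cis.
  apply Rlt_le_trans with ((r * r - r + 1) * (Cnorm z * Cnorm z)).
  - apply Rmult_lt_compat_r; nra.
  - apply sq_sub_add_one_mul_le; lra.
Qed.

Lemma Csub_one_sector_le (a : R) (z : Cx) :
  a <= PI / 3 -> sector a z -> Cnorm z <= 1 -> Cnorm (Csub z Cone) <= 1.
Proof.
  intros Ha Hs Hz.
  replace z with (Cmul z Cone) by ring.
  apply Csub_sector_le with a; auto.
  - rewrite Cnorm_one; lra.
  - now replace (Cmul z Cone) with z by ring.
Qed.

(** * Products of elements of a disk around 1 *)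

Lemma asin_bounds_pos (K : R) : 0 < K < 1 -> 0 < asin K < PI / 2.
Proof.
  intros HK; pose proof (asin_bound K); pose proof (sin_asin K ltac:(lra)) as E.
  pose proof PI_RGT_0.
  split.
  - destruct (Rlt_le_dec 0 (asin K)); [assumption|].
    assert (sin (asin K) <= sin 0) by (apply sin_incr_1; lra).
    rewrite sin_0 in *; lra.
  - destruct (Rlt_le_dec (asin K) (PI / 2)); [assumption|].
    assert (asin K = PI / 2) as E' by lra.
    rewrite E', sin_PI2 in E; lra.
Qed.

(* The near boundary of the disk [B(1, K)] in polar coordinates is
   [r = cos t - sqrt (K^2 - sin^2 t)]. *)
Lemma ball_polar (K : R) (z : Cx) :
  0 < K < 1 -> in_ball Cone K z ->
  exists r t : R, z = cis r t /\ 0 < r /\ Rabs t < asin K /\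
    cos t - sqrt (K * K - sin t * sin t) <= r.
Proof.
  intros HK Hz; unfold in_ball in Hz.
  assert (H2 : Cnorm2 (Csub z Cone) < K * K).
  { rewrite <- Cnorm_sqr; pose proof (Cnorm_nonneg (Csub z Cone)); nra. }
  assert (HRe : 0 < Re z).
  { unfold Cnorm2 in H2; simpl in H2; nra. }
  assert (Hz0 : z <> Czero) by (intros ->; simpl in HRe; lra).
  pose proof (Cnorm_pos z Hz0) as Hr.
  pose proof (Cnorm_sqr z) as Hn.
  assert (E : Cnorm2 (Csub z Cone) = Cnorm z * Cnorm z - 2 * Re z + 1).
  { rewrite Hn; unfold Cnorm2; simpl; ring. }
  rewrite E in H2.
  set (s := Im z / Cnorm z).
  assert (Es : Im z = Cnorm z * s) by (unfold s; field; lra).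
  (* The sine of the argument is bounded by its value [K] on the tangents from 0. With [r = |z|],
     the disk gives [Re z > (r^2 + 1 - K^2) / 2], and the square of the right-hand side is at least
     [r^2 (1 - K^2)] by the inequality of means. *)
  assert (Hs2 : s * s < K * K).
  { assert (Im z * Im z = Cnorm z * Cnorm z - Re z * Re z)
      by (rewrite Hn; unfold Cnorm2; ring).
    apply Rmult_lt_reg_l with (Cnorm z * Cnorm z); [nra|].
    replace (Cnorm z * Cnorm z * (s * s)) with (Im z * Im z) by (rewrite Es; ring).
    assert (0 <= (Cnorm z * Cnorm z - (1 - K * K)) * (Cnorm z * Cnorm z - (1 - K * K)))
      by apply Rle_0_sqr.
    assert (0 < (Cnorm z * Cnorm z + 1 - K * K) / 2 < Re z) by nra.
    assert (((Cnorm z * Cnorm z + 1 - K * K) / 2) * ((Cnorm z * Cnorm z + 1 - K * K) / 2)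
            < Re z * Re z) by nra.
    nra. }
  assert (Hs : - K < s < K) by nra.
  pose proof (asin_bound s) as Hb; pose proof (sin_asin s ltac:(lra)) as Esin.
  pose proof (asin_bounds_pos K HK) as HaK; pose proof (sin_asin K ltac:(lra)) as EK.
  assert (Hcos : Cnorm z * cos (asin s) = Re z).
  { apply Rsqr_inj.
    - apply Rmult_le_pos; [lra|apply cos_ge_0; lra].
    - lra.
    - pose proof (sin2_cos2 (asin s)) as H; unfold Rsqr in *; rewrite Esin in H.
      replace (Cnorm z * cos (asin s) * (Cnorm z * cos (asin s)))
        with (Cnorm z * Cnorm z * (cos (asin s) * cos (asin s))) by ring.
      replace (cos (asin s) * cos (asin s)) with (1 - s * s) by lra.
      transitivity (Cnorm z * Cnorm z - Im z * Im z); [rewrite Es; ring|].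
      rewrite Hn; unfold Cnorm2; ring. }
  exists (Cnorm z), (asin s); repeat split.
  - unfold cis; rewrite Esin, Hcos; apply Cx_eq; simpl; auto.
  - assumption.
  - apply Rabs_def1.
    + apply sin_increasing_0; lra.
    + apply sin_increasing_0; try lra; rewrite sin_neg; lra.
  - rewrite Esin.
    assert (Hq : Rsqr (Cnorm z - cos (asin s)) <= K * K - s * s).
    { pose proof (sin2_cos2 (asin s)) as H; unfold Rsqr in *; rewrite Esin in H.
      nra. }
    apply sqrt_le_1_alt in Hq; rewrite sqrt_Rsqr_abs in Hq.
    apply Rabs_le_bounds in Hq; lra.
Qed.

Lemma ball_sector (K : R) (z : Cx) :
  0 < K < 1 -> in_ball Cone K z -> sector (asin K) z.
Proof.
  intros HK Hz; destruct (ball_polar K z HK Hz) as (r & t & E & Hr & Ht & _).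
  exists r, t; repeat split; auto; lra.
Qed.

Lemma Cprod_ball_sector (K : R) (zs : list Cx) :
  0 < K < 1 -> Forall (in_ball Cone K) zs ->
  sector (INR (length zs) * asin K) (Cprod zs).
Proof.
  intros HK; induction zs as [|z zs IH]; intros H.
  - simpl; apply sector_one; lra.
  - inversion_clear H; simpl Cprod.
    change (length (z :: zs)) with (S (length zs)); rewrite S_INR.
    replace ((INR (length zs) + 1) * asin K) with (asin K + INR (length zs) * asin K) by ring.
    apply sector_mul; [now apply ball_sector|now apply IH].
Qed.

Lemma sin_mul_nat_le (n : nat) (t : R) : Rabs (sin (INR n * t)) <= INR n * Rabs (sin t).
Proof.
  induction n as [|n IH].
  - simpl; rewrite !Rmult_0_l, sin_0, Rabs_R0; lra.
  - rewrite S_INR, Rmult_plus_distr_r, Rmult_1_l, sin_plus.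
    eapply Rle_trans; [apply Rabs_triang|]; rewrite !Rabs_mult.
    pose proof (COS_bound t); pose proof (COS_bound (INR n * t)).
    assert (Rabs (cos t) <= 1) by (apply Rabs_le; lra).
    assert (Rabs (cos (INR n * t)) <= 1) by (apply Rabs_le; lra).
    pose proof (Rabs_pos (sin t)); pose proof (Rabs_pos (sin (INR n * t))).
    nra.
Qed.

Lemma pow_lt_mono (x y : R) (n : nat) : 0 <= x -> x < y -> n <> 0%nat -> x ^ n < y ^ n.
Proof.
  intros Hx Hxy Hn; destruct n as [|n]; [contradiction|]; simpl.
  pose proof (pow_incr x y n ltac:(lra)); pose proof (pow_lt y n ltac:(lra)).
  pose proof (pow_le x n Hx); nra.
Qed.

(** The right-hand side is the real part of the [d]-th power of the near-arc point at argument [t].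
    It equals [(1 - K)^d] at [t = 0] and is nondecreasing: after squaring, its derivative is seen to
    be nonnegative as soon as [K sin (d t) <= sin t], which follows from [sin (d t) <= d sin t] and
    [d K <= 1]. *)
Lemma near_arc_pow_cos (K t : R) (d : nat) :
  0 < K < 1 -> INR d * K <= 1 -> INR d * asin K < PI / 2 ->
  0 <= t < asin K ->
  (1 - K) ^ d <= (cos t - sqrt (K * K - sin t * sin t)) ^ d * cos (INR d * t).
Proof.
  intros HK HdK HdA Ht.
  pose proof (asin_bounds_pos K HK) as HaK; pose proof (sin_asin K ltac:(lra)) as EK.
  set (S x := sqrt (K * K - sin x * sin x)).
  set (f x := (cos x - S x) ^ d * cos (INR d * x)).
  assert (Hf0 : f 0 = (1 - K) ^ d).
  { unfold f, S; rewrite Rmult_0_r, cos_0, sin_0.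
    replace (K * K - 0 * 0) with (K * K) by ring.
    rewrite sqrt_square by lra; ring. }
  rewrite <- Hf0; change (f 0 <= f t).
  destruct (Req_dec t 0) as [->|Ht0]; [lra|].
  assert (Hsin : forall c, 0 <= c <= t -> 0 <= sin c < K).
  { intros c Hc; split; [apply sin_ge_0; lra|].
    rewrite <- EK; apply sin_increasing_1; lra. }
  (* [cos - S] has derivative [(cos - S) sin / S], so the derivative of [f] keeps the full power [d]
     as a common factor. *)
  destruct (MVT_cor2 f
    (fun x => INR d * (cos x - S x) ^ d * ((sin x * cos (INR d * x) - S x * sin (INR d * x)) / S x))
    0 t) as (c & Hc & Hc1).
  - lra.
  - intros c Hc; apply is_derive_Reals; specialize (Hsin c Hc).
    assert (HS : 0 < S c) by (apply sqrt_lt_R0; nra).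
    unfold f, S in *; auto_derive; [nra|].
    change (K * K + - (sin c * sin c)) with (K * K - sin c * sin c).
    set (q := sqrt (K * K - sin c * sin c)) in *.
    destruct d as [|d]; [simpl; field; lra|].
    simpl Init.Nat.pred; change (cos c + - q) with (cos c - q); rewrite <- !tech_pow_Rmult; field; lra.
  - assert (Hc' : 0 <= c <= t) by lra; specialize (Hsin c Hc').
    assert (HS : 0 < S c) by (apply sqrt_lt_R0; nra).
    assert (HS2 : S c * S c = K * K - sin c * sin c) by (apply sqrt_sqrt; nra).
    pose proof (sin2_cos2 c) as Hsc; unfold Rsqr in Hsc.
    assert (Hcc : 0 < cos c) by (apply cos_gt_0; lra).
    assert (HcS : 0 <= cos c - S c) by nra.
    assert (Hd0 : 0 <= INR d) by apply pos_INR.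
    assert (Hdc : 0 <= INR d * c < PI / 2) by nra.
    assert (0 <= sin (INR d * c)) by (apply sin_ge_0; lra).
    assert (0 < cos (INR d * c)) by (apply cos_gt_0; lra).
    assert (Hk : K * sin (INR d * c) <= sin c).
    { pose proof (sin_mul_nat_le d c) as H1.
      rewrite !Rabs_pos_eq in H1 by lra; nra. }
    assert (0 <= sin c * cos (INR d * c) - S c * sin (INR d * c)).
    { pose proof (sin2_cos2 (INR d * c)) as Hsd; unfold Rsqr in Hsd.
      cut (S c * sin (INR d * c) <= sin c * cos (INR d * c)); [lra|].
      apply Rsqr_incr_0_var; [unfold Rsqr|nra].
      replace (S c * sin (INR d * c) * (S c * sin (INR d * c)))
        with (S c * S c * (sin (INR d * c) * sin (INR d * c))) by ring.
      rewrite HS2.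
      replace (sin c * cos (INR d * c) * (sin c * cos (INR d * c)))
        with (sin c * sin c * (cos (INR d * c) * cos (INR d * c))) by ring.
      replace (cos (INR d * c) * cos (INR d * c))
        with (1 - sin (INR d * c) * sin (INR d * c)) by lra.
      assert (K * sin (INR d * c) * (K * sin (INR d * c)) <= sin c * sin c)
        by (apply Rmult_le_compat; nra).
      lra. }
    assert (0 <= f t - f 0); [|lra].
    rewrite Hc; apply Rmult_le_pos; [|lra].
    apply Rmult_le_pos; [apply Rmult_le_pos; [assumption|now apply pow_le]|].
    apply Rle_mult_inv_pos; assumption.
Qed.

Lemma cos_below_tangent (x m : R) :
  - (PI / 2) <= x <= PI / 2 -> - (PI / 2) <= m <= PI / 2 ->
  cos x <= cos m - sin m * (x - m).
Proof.
  intros Hx Hm.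
  destruct (Rtotal_order x m) as [H|[->|H]]; [|lra|].
  - destruct (MVT_cor2 cos (fun c => - sin c) x m H) as (c & E & Hc).
    + intros; apply derivable_pt_lim_cos.
    + assert (sin c <= sin m) by (apply sin_incr_1; lra); nra.
  - destruct (MVT_cor2 cos (fun c => - sin c) m x H) as (c & E & Hc).
    + intros; apply derivable_pt_lim_cos.
    + assert (sin m <= sin c) by (apply sin_incr_1; lra); nra.
Qed.

(* Log-concavity of the cosine, in tangent-line form. *)
Lemma cos_le_exp_tangent (x m : R) :
  - (PI / 2) <= x <= PI / 2 -> - (PI / 2) < m < PI / 2 ->
  cos x <= cos m * exp (- (tan m * (x - m))).
Proof.
  intros Hx Hm.
  assert (Hc : 0 < cos m) by (apply cos_gt_0; lra).
  eapply Rle_trans; [apply (cos_below_tangent x m); lra|].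
  pose proof (exp_ineq1_le (- (tan m * (x - m)))) as He.
  apply (Rmult_le_compat_l (cos m)) in He; [|lra].
  eapply Rle_trans; [|apply He].
  unfold tan; right; field; lra.
Qed.

(* Each factor [r e^(it)] satisfies [r^d cos (d t) >= (1-K)^d]. Replacing
   [cos (d t)] by the exponential majorant tangent at the total angle [m], the
   exponentials multiply to 1. *)
Lemma Re_Cprod_ball (K : R) (zs : list Cx) :
  0 < K < 1 -> INR (length zs) * K <= 1 -> INR (length zs) * asin K < PI / 2 ->
  Forall (in_ball Cone K) zs -> (1 - K) ^ length zs <= Re (Cprod zs).
Proof.
  intros HK HdK HdA Hzs.
  pose proof (asin_bounds_pos K HK) as HaK.
  set (d := length zs) in *.
  assert (Hsingle : forall z, in_ball Cone K z ->
    exists r t, z = cis r t /\ 0 < r /\ Rabs t < asin K /\ (1 - K) ^ d <= r ^ d * cos (INR d * t)).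
  { intros z Hz; destruct (ball_polar K z HK Hz) as (r & t & E & Hr & Ht & Hb).
    exists r, t; repeat split; auto.
    assert (Hcd : 0 <= cos (INR d * t)).
    { rewrite <- cos_Rabs, Rabs_mult, (Rabs_pos_eq (INR d)) by apply pos_INR.
      pose proof (Rabs_pos t); pose proof (pos_INR d); apply cos_ge_0; nra. }
    eapply Rle_trans.
    - apply (near_arc_pow_cos K (Rabs t) d HK HdK HdA); split; [apply Rabs_pos|assumption].
    - assert (Hss : sin (Rabs t) * sin (Rabs t) = sin t * sin t).
      { unfold Rabs; destruct (Rcase_abs t); [rewrite sin_neg; ring|reflexivity]. }
      rewrite cos_Rabs, Hss.
      assert (Ecd : cos (INR d * Rabs t) = cos (INR d * t)).
      { rewrite <- (cos_Rabs (INR d * t)), Rabs_mult, (Rabs_pos_eq (INR d)) by apply pos_INR.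
        reflexivity. }
      rewrite Ecd; apply Rmult_le_compat_r; [assumption|].
      apply pow_incr; split; [|assumption].
      cut (sqrt (K * K - sin t * sin t) <= sqrt (cos t * cos t)).
      + rewrite sqrt_square; [lra|].
        apply Rabs_def2 in Ht; apply cos_ge_0; lra.
      + apply sqrt_le_1_alt.
        pose proof (sin2_cos2 t) as H; unfold Rsqr in H; nra. }
  (* [d] remains the length of the whole list while [l] grows. [m] is quantified because the tangent
     point, the argument of the full product, is known only at the end. *)
  assert (Hprod : forall l, Forall (in_ball Cone K) l ->
    exists r t, Cprod l = cis r t /\ 0 < r /\ Rabs t <= INR (length l) * asin K /\
      forall m, Rabs m < PI / 2 ->
      ((1 - K) ^ d) ^ length l * exp (tan m * (INR d * t - INR (length l) * m))
        <= r ^ d * cos m ^ length l).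
  { intros l.
    induction l as [|z l IH]; intros Hl.
    - exists 1, 0; repeat split; simpl.
      + unfold cis; rewrite cos_0, sin_0; apply Cx_eq; simpl; ring.
      + lra.
      + rewrite Rabs_R0; lra.
      + intros m _; replace (tan m * (INR d * 0 - 0 * m)) with 0 by ring.
        rewrite exp_0, pow1; lra.
    - inversion_clear Hl as [|? ? Hz Hl'].
      destruct (IH Hl') as (r & t & E & Hr & Ht & Hb).
      destruct (Hsingle z Hz) as (r' & t' & E' & Hr' & Ht' & Hb').
      exists (r' * r), (t' + t).
      change (Cprod (z :: l)) with (Cmul z (Cprod l)).
      change (length (z :: l)) with (Datatypes.S (length l)).
      rewrite S_INR, E, E', cis_mul; repeat split.
      + now apply Rmult_lt_0_compat.
      + pose proof (Rabs_triang t' t); lra.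
      + intros m Hm; specialize (Hb m Hm); apply Rabs_def2 in Hm.
        assert (Hcm : 0 < cos m) by (apply cos_gt_0; lra).
        rewrite <- !tech_pow_Rmult, Rpow_mult_distr.
        replace (tan m * (INR d * (t' + t) - (INR (length l) + 1) * m))
          with (tan m * (INR d * t' - m) + tan m * (INR d * t - INR (length l) * m)) by ring.
        rewrite exp_plus.
        assert (Hx : cos (INR d * t') <= cos m * exp (- (tan m * (INR d * t' - m)))).
        { apply cos_le_exp_tangent; [|lra].
          apply Rabs_le_bounds.
          rewrite Rabs_mult, (Rabs_pos_eq (INR d)) by apply pos_INR.
          pose proof (Rabs_pos t'); pose proof (pos_INR d); nra. }
        assert (H1 : (1 - K) ^ d * exp (tan m * (INR d * t' - m)) <= r' ^ d * cos m).
        { apply Rmult_le_reg_r with (exp (- (tan m * (INR d * t' - m)))); [apply exp_pos|].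
          rewrite Rmult_assoc, <- exp_plus, Rplus_opp_r, exp_0, Rmult_1_r.
          eapply Rle_trans; [apply Hb'|].
          rewrite Rmult_assoc; apply Rmult_le_compat_l; [|assumption].
          apply pow_le; lra. }
        replace ((1 - K) ^ d * ((1 - K) ^ d) ^ length l *
          (exp (tan m * (INR d * t' - m)) * exp (tan m * (INR d * t - INR (length l) * m))))
          with ((1 - K) ^ d * exp (tan m * (INR d * t' - m)) *
            (((1 - K) ^ d) ^ length l * exp (tan m * (INR d * t - INR (length l) * m)))) by ring.
        replace (r' ^ d * r ^ d * (cos m * cos m ^ length l))
          with ((r' ^ d * cos m) * (r ^ d * cos m ^ length l)) by ring.
        assert (0 < 1 - K) by lra.
        apply Rmult_le_compat; try assumption; apply Rmult_le_pos;
          try (left; apply exp_pos); repeat apply pow_le; lra. }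
  destruct (Hprod zs Hzs) as (r & t & E & Hr & Ht & Hb); fold d in Ht, Hb.
  (* With [m = t] the exponent vanishes and [(r cos t)^d >= ((1 - K)^d)^d] remains. The claim is its
     [d]-th root, so [d = 0] is treated apart. *)
  specialize (Hb t ltac:(lra)).
  replace (tan t * (INR d * t - INR d * t)) with 0 in Hb by ring.
  rewrite exp_0, Rmult_1_r, <- Rpow_mult_distr in Hb.
  rewrite E; simpl.
  assert (Hct : 0 < cos t).
  { assert (H : Rabs t < PI / 2) by lra; apply Rabs_def2 in H; apply cos_gt_0; lra. }
  destruct (Nat.eq_dec d 0) as [Hd|Hd].
  - assert (zs = []) as -> by (now apply length_zero_iff_nil).
    assert (Ht0 : Rabs t <= 0) by (rewrite Hd in Ht; simpl in Ht; lra).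
    assert (r * cos t = 1) by (change (Re (cis r t) = 1); rewrite <- E; reflexivity).
    rewrite Hd; simpl; lra.
  - apply Rnot_lt_le; intros Hlt.
    assert (0 < r * cos t) by (now apply Rmult_lt_0_compat).
    assert ((r * cos t) ^ d < ((1 - K) ^ d) ^ d); [|lra].
    apply pow_lt_mono; [lra|assumption|assumption].
Qed.

(** * Partition functions with vertex activities *)

Definition Csum {A : Type} (f : A -> Cx) (l : list A) : Cx :=
  fold_right (fun x acc => Cadd (f x) acc) Czero l.

Lemma Csum_ext {A : Type} (f g : A -> Cx) (l : list A) :
  (forall x, In x l -> f x = g x) -> Csum f l = Csum g l.
Proof.
  induction l as [|x l IH]; intros H; [reflexivity|]; simpl.
  rewrite (H x) by (now left); rewrite IH; [reflexivity|].
  intros; apply H; now right.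
Qed.

Lemma Csum_zero {A : Type} (l : list A) : Csum (fun _ => Czero) l = Czero.
Proof. induction l as [|x l IH]; simpl; [reflexivity|]; rewrite IH; ring. Qed.

Lemma Csum_add {A : Type} (f g : A -> Cx) (l : list A) :
  Csum (fun x => Cadd (f x) (g x)) l = Cadd (Csum f l) (Csum g l).
Proof. induction l as [|x l IH]; simpl; [ring|]; rewrite IH; ring. Qed.

Lemma Csum_mul_l {A : Type} (a : Cx) (f : A -> Cx) (l : list A) :
  Csum (fun x => Cmul a (f x)) l = Cmul a (Csum f l).
Proof. induction l as [|x l IH]; simpl; [ring|]; rewrite IH; ring. Qed.

Lemma Csum_mul_r {A : Type} (a : Cx) (f : A -> Cx) (l : list A) :
  Csum (fun x => Cmul (f x) a) l = Cmul (Csum f l) a.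
Proof. induction l as [|x l IH]; simpl; [ring|]; rewrite IH; ring. Qed.

Lemma Csum_swap {A B : Type} (f : A -> B -> Cx) (l : list A) (m : list B) :
  Csum (fun x => Csum (f x) m) l = Csum (fun y => Csum (fun x => f x y) l) m.
Proof.
  induction l as [|x l IH]; simpl.
  - now rewrite Csum_zero.
  - now rewrite IH, <- Csum_add.
Qed.

Lemma Csum_single (f : nat -> Cx) (j : nat) (l : list nat) :
  NoDup l -> In j l -> (forall i, In i l -> i <> j -> f i = Czero) -> Csum f l = f j.
Proof.
  induction l as [|x l IH]; intros Hd Hj H; [now elim Hj|]; simpl.
  apply NoDup_cons_iff in Hd as [Hx Hd].
  destruct Hj as [->|Hj].
  - rewrite (Csum_ext f (fun _ => Czero)), Csum_zero; [ring|].
    intros i Hi; apply H; [now right|]; congruence.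
  - rewrite IH, (H x); auto; [ring|now left|congruence|].
    intros i Hi; apply H; now right.
Qed.

(** Each term may fall short of [a] by [b] per unit of [n x]. The form suits a situation where only
    the total of the counts is controlled, not their distribution over the terms. *)
Lemma Re_Csum_lower {A : Type} (f : A -> Cx) (n : A -> nat) (a b : R) (l : list A) :
  (forall x, In x l -> a - b * INR (n x) <= Re (f x)) ->
  a * INR (length l) - b * INR (list_sum (map n l)) <= Re (Csum f l).
Proof.
  induction l as [|x l IH]; intros H; [simpl; lra|].
  change (length (x :: l)) with (S (length l)).
  change (list_sum (map n (x :: l))) with (n x + list_sum (map n l))%nat.
  rewrite S_INR, plus_INR; simpl Re.
  pose proof (H x (or_introl eq_refl)).
  pose proof (IH (fun y Hy => H y (or_intror Hy))); lra.
Qed.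

Lemma list_argmax (f : nat -> R) (l : list nat) :
  l <> [] -> exists m, In m l /\ forall x, In x l -> f x <= f m.
Proof.
  induction l as [|x l IH]; intros H; [contradiction|].
  destruct l as [|y l].
  - exists x; split; [now left|]; intros z [->|[]]; lra.
  - destruct IH as (m & Hm & Hmax); [discriminate|].
    destruct (Rle_dec (f x) (f m)) as [Hle|Hgt].
    + exists m; split; [now right|]; intros z [->|Hz]; auto.
    + exists x; split; [now left|]; intros z [->|Hz]; [lra|].
      specialize (Hmax z Hz); lra.
Qed.

Section Partition.

Variables (k : nat) (adj : nat -> nat -> bool) (w : nat -> nat -> Cx).
Hypothesis adj_sym : forall u v, adj u v = adj v u.
Hypothesis w_sym : forall u v, w u v = w v u.

Definition edge_factor (u l v c : nat) : Cx :=
  if adj u v && (c =? l) then w u v else Cone.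

Lemma edge_factor_sym (u l v c : nat) : edge_factor u l v c = edge_factor v c u l.
Proof.
  unfold edge_factor; rewrite (adj_sym v u), (w_sym v u), (Nat.eqb_sym l c); reflexivity.
Qed.

(* Effect on the remaining vertices of giving colour [l] to vertex [u]. *)
Definition pin (act : nat -> nat -> Cx) (u l v c : nat) : Cx :=
  Cmul (edge_factor u l v c) (act v c).

(** The partition function of the graph induced on [S], with an activity for each vertex and colour.
    An edge is charged when the endpoint that comes earlier in the list is eliminated. *)
Fixpoint Zact (S : list nat) (act : nat -> nat -> Cx) : Cx :=
  match S with
  | [] => Cone
  | u :: S' => Csum (fun l => Cmul (act u l) (Zact S' (pin act u l))) (seq 1 k)
  end.

Lemma Zact_ext (S : list nat) (act act' : nat -> nat -> Cx) :
  (forall v c, In v S -> In c (seq 1 k) -> act v c = act' v c) -> Zact S act = Zact S act'.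
Proof.
  revert act act'; induction S as [|u S IH]; intros act act' H; [reflexivity|]; simpl.
  apply Csum_ext; intros l Hl; f_equal.
  - apply H; [now left|assumption].
  - apply IH; intros v c Hv Hc; unfold pin; f_equal; apply H; [now right|assumption].
Qed.

(** Two consecutive eliminations commute, because the edge between the exchanged vertices may be
    charged to either end. Hence any chosen vertex can be eliminated first. *)
Lemma Zact_perm (S S' : list nat) (act : nat -> nat -> Cx) :
  Permutation S S' -> Zact S act = Zact S' act.
Proof.
  intros H; revert act; induction H as [|u S S' H IH|u v S|S S' S'' H IH H' IH']; intros act.
  - reflexivity.
  - simpl; apply Csum_ext; intros l _; now rewrite IH.
  - simpl.
    rewrite (Csum_ext _ (fun l => Csum (fun m => Cmul (act v l) (Cmul (pin act v l u m)
               (Zact S (pin (pin act v l) u m)))) (seq 1 k)))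
      by (intros; now rewrite Csum_mul_l).
    rewrite (Csum_ext (fun l => Cmul (act u l) _)
               (fun l => Csum (fun m => Cmul (act u l) (Cmul (pin act u l v m)
                 (Zact S (pin (pin act u l) v m)))) (seq 1 k)))
      by (intros; now rewrite Csum_mul_l).
    rewrite Csum_swap; apply Csum_ext; intros l _; apply Csum_ext; intros m _.
    rewrite (Zact_ext S (pin (pin act v m) u l) (pin (pin act u l) v m))
      by (intros; unfold pin; ring).
    change (pin act v m u l) with (Cmul (edge_factor v m u l) (act u l)).
    change (pin act u l v m) with (Cmul (edge_factor u l v m) (act v m)).
    rewrite (edge_factor_sym v m u l); ring.
  - now rewrite IH.
Qed.

Lemma Zact_pinned (x l : nat) (S : list nat) (act : nat -> nat -> Cx) :
  In l (seq 1 k) -> (forall c, In c (seq 1 k) -> c <> l -> act x c = Czero) ->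
  Zact (x :: S) act = Cmul (act x l) (Zact S (pin act x l)).
Proof.
  intros Hl H; simpl.
  rewrite (Csum_single _ l); auto using seq_NoDup.
  intros c Hc Hne; rewrite H by assumption; ring.
Qed.

(** * Pendant fixed vertices *)

(* [(v, (x, l))] stands for a leaf of colour [l] joined to [v] by an edge of weight [x]. *)
Definition pendant : Type := (nat * (Cx * nat))%type.

Definition pendant_factor (p : pendant) (v c : nat) : Cx :=
  if (fst p =? v) && (c =? snd (snd p)) then fst (snd p) else Cone.

Definition act_of (P : list pendant) (v c : nat) : Cx :=
  fold_right (fun p acc => Cmul (pendant_factor p v c) acc) Cone P.

Definition pendants_of (u l : nat) (T : list nat) : list pendant :=
  map (fun v => (v, (w u v, l))) (filter (adj u) T).

Lemma act_of_app (P Q : list pendant) (v c : nat) :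
  act_of (P ++ Q) v c = Cmul (act_of P v c) (act_of Q v c).
Proof. induction P as [|p P IH]; simpl; [ring|]; rewrite IH; ring. Qed.

Lemma act_of_pendants_notin (u l v c : nat) (T : list nat) :
  ~ In v T -> act_of (pendants_of u l T) v c = Cone.
Proof.
  unfold pendants_of; induction T as [|x T IH]; intros H; [reflexivity|]; simpl.
  assert (x <> v /\ ~ In v T) as [Hx HT] by (split; intros ?; apply H; [now left|now right]).
  destruct (adj u x); simpl; [|now apply IH].
  rewrite IH by assumption; unfold pendant_factor; simpl.
  apply Nat.eqb_neq in Hx as ->; simpl; ring.
Qed.

Lemma act_of_pendants (u l v c : nat) (T : list nat) :
  NoDup T -> In v T -> act_of (pendants_of u l T) v c = edge_factor u l v c.
Proof.
  induction T as [|x T IH]; intros Hd Hv; [now elim Hv|].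
  apply NoDup_cons_iff in Hd as [Hx Hd].
  destruct Hv as [->|Hv].
  - pose proof (act_of_pendants_notin u l v c T Hx) as E.
    unfold pendants_of in *; simpl; unfold edge_factor.
    destruct (adj u v); simpl; [|assumption].
    rewrite E; unfold pendant_factor; simpl; rewrite Nat.eqb_refl; simpl; ring.
  - specialize (IH Hd Hv); unfold pendants_of in *; simpl.
    destruct (adj u x); simpl; [|assumption].
    rewrite IH; unfold pendant_factor; simpl.
    assert (E : x <> v) by congruence; apply Nat.eqb_neq in E as ->; simpl; ring.
Qed.

(** Activities that come from pendants stay of this kind after an elimination, so the recursion
    never leaves the class. *)
Lemma Zact_pin_act_of (P : list pendant) (u l : nat) (S : list nat) :
  NoDup S -> Zact S (pin (act_of P) u l) = Zact S (act_of (pendants_of u l S ++ P)).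
Proof.
  intros Hd; apply Zact_ext; intros v c Hv _.
  now rewrite act_of_app, act_of_pendants.
Qed.

Definition pendants_at (P : list pendant) (v : nat) : nat :=
  length (filter (fun p => fst p =? v) P).

Definition pendants_col (P : list pendant) (v c : nat) : nat :=
  length (filter (fun p => (fst p =? v) && (c =? snd (snd p))) P).

Lemma pendants_at_app (P Q : list pendant) (v : nat) :
  pendants_at (P ++ Q) v = (pendants_at P v + pendants_at Q v)%nat.
Proof. unfold pendants_at; now rewrite filter_app, length_app. Qed.

Lemma pendants_at_pendants_of (u l v : nat) (T : list nat) :
  NoDup T -> In v T ->
  pendants_at (pendants_of u l T) v = (if adj u v then 1 else 0)%nat.
Proof.
  assert (H0 : forall T, ~ In v T -> pendants_at (pendants_of u l T) v = 0%nat).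
  { clear T; unfold pendants_at, pendants_of; induction T as [|x T IH]; intros H; [reflexivity|].
    assert (x <> v /\ ~ In v T) as [Hx HT] by (split; intros ?; apply H; [now left|now right]).
    simpl; destruct (adj u x); simpl; [|now apply IH].
    apply Nat.eqb_neq in Hx as ->; now apply IH. }
  induction T as [|x T IH]; intros Hd Hv; [now elim Hv|].
  apply NoDup_cons_iff in Hd as [Hx Hd].
  destruct Hv as [->|Hv].
  - specialize (H0 T Hx); unfold pendants_at, pendants_of in *; simpl.
    destruct (adj u v); simpl; [|assumption].
    rewrite Nat.eqb_refl; simpl; now rewrite H0.
  - specialize (IH Hd Hv); unfold pendants_at, pendants_of in *; simpl.
    destruct (adj u x); simpl; [|assumption].
    assert (E : x <> v) by congruence; apply Nat.eqb_neq in E as ->; assumption.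
Qed.

Lemma sum_indicator_le1 (c : nat) (l : list nat) :
  NoDup l -> (list_sum (map (fun j => if j =? c then 1 else 0) l) <= 1)%nat.
Proof.
  induction l as [|x l IH]; intros Hd; [simpl; lia|].
  apply NoDup_cons_iff in Hd as [Hx Hd]; simpl.
  destruct (Nat.eqb_spec x c) as [->|_]; [|now apply IH].
  cut (list_sum (map (fun j => if j =? c then 1 else 0) l) = 0)%nat; [lia|].
  clear -Hx; induction l as [|y l IH]; [reflexivity|]; simpl.
  destruct (Nat.eqb_spec y c) as [->|_]; [elim Hx; now left|].
  apply IH; intros H; apply Hx; now right.
Qed.

(** A pendant has one colour, hence is counted for at most one member of a list without repetitions.
    The list varies in use: all colours, a single one, or a pair. *)
Lemma sum_pendants_col (P : list pendant) (v : nat) (l : list nat) :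
  NoDup l -> (list_sum (map (pendants_col P v) l) <= pendants_at P v)%nat.
Proof.
  intros Hd; induction P as [|p P IH].
  - unfold pendants_col, pendants_at; simpl; clear.
    induction l; simpl; lia.
  - unfold pendants_at in *; simpl.
    destruct (Nat.eqb_spec (fst p) v) as [E|E].
    + apply Nat.le_trans with (1 + list_sum (map (pendants_col P v) l))%nat; [|simpl; lia].
      pose proof (sum_indicator_le1 (snd (snd p)) l Hd) as H1.
      apply Nat.le_trans with (list_sum (map (fun j => if j =? snd (snd p) then 1 else 0) l)
        + list_sum (map (pendants_col P v) l))%nat; [|lia].
      clear -E; induction l as [|j l IH]; [simpl; lia|]; simpl.
      replace (pendants_col (p :: P) v j)
        with ((if (j =? snd (snd p))%nat then 1 else 0) + pendants_col P v j)%nat; [lia|].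
      unfold pendants_col; simpl; rewrite E, Nat.eqb_refl; simpl.
      now destruct (j =? snd (snd p)).
    + eapply Nat.le_trans; [|apply IH].
      clear -E; apply Nat.eqb_neq in E; unfold pendants_col; simpl; rewrite E; simpl; lia.
Qed.

Lemma pendants_col_pair (P : list pendant) (v l l' : nat) :
  l <> l' -> (pendants_col P v l + pendants_col P v l' <= pendants_at P v)%nat.
Proof.
  intros H; pose proof (sum_pendants_col P v [l; l']) as Hs; simpl in Hs.
  assert (NoDup [l; l']) by (repeat constructor; simpl; intuition congruence).
  specialize (Hs ltac:(assumption)); lia.
Qed.

End Partition.

Lemma filter_perm_length (f : nat -> bool) (S S' : list nat) :
  Permutation S S' -> length (filter f S) = length (filter f S').
Proof.
  induction 1 as [|x S S' _ IH|x y S|S S' S'' _ IH _ IH']; simpl; auto.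
  - destruct (f x); simpl; auto.
  - destruct (f x), (f y); reflexivity.
  - congruence.
Qed.

(** * Admissible pendant configurations and their recolouring *)

Section Admissible.

Variables (D k : nat) (eps K : R) (adj : nat -> nat -> bool) (w : nat -> nat -> Cx).
Hypothesis adj_sym : forall u v, adj u v = adj v u.

Local Notation Z := (Zact k adj w).

(** The two kinds of edge weights, with the bound on the argument expressed by a sector, which
    already excludes 0. *)
Definition ok_weight (z : Cx) : Prop :=
  Cnorm z <= eps \/ (sector (eps * asin K) z /\ Cnorm z <= 1).

Definition ok_pendants (P : list pendant) : Prop :=
  forall p, In p P -> ok_weight (fst (snd p)).

Hypothesis w_ok : forall u v, adj u v = true -> ok_weight (w u v).

(** Membership of the quotient in [B(1, K)^d], written multiplicatively so that steps can be chained
    without dividing. *)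
Definition ball_ratio (d : nat) (z z' : Cx) : Prop :=
  exists zs, length zs = d /\ Forall (in_ball Cone K) zs /\ z = Cmul (Cprod zs) z'.

Definition admissible (S : list nat) (P : list pendant) : Prop :=
  NoDup S /\ ok_pendants P /\
  forall v, In v S -> (length (filter (adj v) S) + pendants_at P v <= D)%nat.

Definition nonvanishing (S : list nat) : Prop :=
  forall P, admissible S P -> Z S (act_of P) <> Czero.

(** The disk statement of (B) with the denominator cleared. The pendant may stand anywhere in the
    list, since recolouring one at a time reaches pendants in the middle. *)
Definition recolourable (S : list nat) : Prop :=
  forall P1 P2 v x l l', In v S -> In l (seq 1 k) -> In l' (seq 1 k) ->
  admissible S (P1 ++ (v, (x, l)) :: P2) ->
  Cnorm (Csub (Z S (act_of (P1 ++ (v, (x, l)) :: P2))) (Z S (act_of (P1 ++ (v, (x, l')) :: P2))))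
    < K * Cnorm (Z S (act_of (P1 ++ (v, (x, l')) :: P2))).

Lemma admissible_recolour (S : list nat) (P1 P2 : list pendant) (v : nat) (x : Cx) (l l' : nat) :
  admissible S (P1 ++ (v, (x, l)) :: P2) -> admissible S (P1 ++ (v, (x, l')) :: P2).
Proof.
  intros (Hd & Hok & Hdeg); repeat split; [assumption| |].
  - intros p Hp; apply in_app_or in Hp as [Hp|[<-|Hp]].
    + apply Hok, in_or_app; now left.
    + apply (Hok (v, (x, l))), in_or_app; right; now left.
    + apply Hok, in_or_app; right; now right.
  - intros v' Hv'; specialize (Hdeg v' Hv'); rewrite !pendants_at_app in *.
    unfold pendants_at in *; simpl in *; now destruct (v =? v').
Qed.

Lemma admissible_perm (S S' : list nat) (P : list pendant) :
  Permutation S S' -> admissible S P -> admissible S' P.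
Proof.
  intros Hp (Hd & Hok & Hdeg); repeat split; [now apply Permutation_NoDup with S|assumption|].
  intros v Hv; rewrite <- (filter_perm_length _ _ _ Hp); apply Hdeg.
  now apply Permutation_in with S'; [apply Permutation_sym|].
Qed.

(** Each neighbour of [u] in [S] loses a free neighbour and gains a pendant, so the sum bounded by
    [D] does not change. *)
Lemma admissible_pin (u l : nat) (S : list nat) (P : list pendant) :
  admissible (u :: S) P -> admissible S (pendants_of adj w u l S ++ P).
Proof.
  intros (Hd & Hok & Hdeg); apply NoDup_cons_iff in Hd as [Hu Hd].
  repeat split; [assumption| |].
  - intros p Hp; apply in_app_or in Hp as [Hp|Hp]; [|now apply Hok].
    apply in_map_iff in Hp as (v & <- & Hv); apply filter_In in Hv as [_ Hv].
    now apply w_ok.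
  - intros v Hv; specialize (Hdeg v (or_intror Hv)); simpl in Hdeg.
    rewrite pendants_at_app, pendants_at_pendants_of by assumption.
    rewrite adj_sym; destruct (adj v u); simpl in *; lia.
Qed.

(* The pendants are recoloured one at a time. *)
Lemma recolour_list (S : list nat) (u l j : nat) :
  nonvanishing S -> recolourable S -> In l (seq 1 k) -> In j (seq 1 k) ->
  forall (T : list nat) (Q P : list pendant), incl T S ->
  admissible S (Q ++ map (fun v => (v, (w u v, l))) T ++ P) ->
  ball_ratio (length T)
    (Z S (act_of (Q ++ map (fun v => (v, (w u v, l))) T ++ P)))
    (Z S (act_of (Q ++ map (fun v => (v, (w u v, j))) T ++ P))).
Proof.
  intros HA HB Hl Hj T; induction T as [|v T IH]; intros Q P HT Hadm.
  - exists []; repeat split; [constructor|]; simpl; ring.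
  - simpl in *.
    assert (Hadm' := admissible_recolour _ _ _ _ _ _ j Hadm).
    pose proof (HB Q _ v (w u v) l j (HT v (or_introl eq_refl)) Hl Hj Hadm) as Hlt.
    pose proof (HA _ Hadm') as Hne.
    set (z := Z S (act_of (Q ++ (v, (w u v, l)) :: map (fun v => (v, (w u v, l))) T ++ P))) in *.
    set (z' := Z S (act_of (Q ++ (v, (w u v, j)) :: map (fun v => (v, (w u v, l))) T ++ P))) in *.
    (* [Q] accumulates the pendants that already have the new colour. *)
    specialize (IH (Q ++ [(v, (w u v, j))]) P (fun y Hy => HT y (or_intror Hy))).
    rewrite <- !app_assoc in IH; simpl in IH.
    destruct (IH Hadm') as (zs & Hlen & Hb & E); fold z' in E.
    exists (Cdiv z z' :: zs); repeat split.
    + simpl; now rewrite Hlen.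
    + constructor; [|assumption]; unfold in_ball.
      pose proof (Cnorm_pos _ Hne) as Hp.
      apply Rmult_lt_reg_r with (Cnorm z'); [assumption|].
      rewrite <- Cnorm_mul.
      replace (Cmul (Csub (Cdiv z z') Cone) z') with (Csub z z'); [assumption|].
      rewrite (Cdiv_mul z z' Hne) at 1; ring.
    + rewrite (Cdiv_mul z z' Hne) at 1; simpl Cprod.
      generalize (Cdiv z z'); intros q.
      etransitivity; [exact (f_equal (Cmul q) E)|].
      apply (Rmul_assoc Cx_ring_theory).
Qed.

Lemma recolour_neighbours (S : list nat) (u l j : nat) (P : list pendant) :
  nonvanishing S -> recolourable S -> In l (seq 1 k) -> In j (seq 1 k) ->
  admissible (u :: S) P ->
  ball_ratio (length (filter (adj u) S))
    (Z S (act_of (pendants_of adj w u l S ++ P)))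
    (Z S (act_of (pendants_of adj w u j S ++ P))).
Proof.
  intros HA HB Hl Hj Hadm.
  apply (recolour_list S u l j HA HB Hl Hj (filter (adj u) S) [] P).
  - apply incl_filter.
  - now apply admissible_pin.
Qed.

End Admissible.

(** * The induction on the number of free vertices *)

Section Induction.

Variables (D k : nat) (eps K : R).
Hypothesis D_ge3 : (3 <= D)%nat.
Hypothesis K_bounds : 0 < K < 1 / (INR D - 1).

Local Notation theta := (asin K).
Local Notation ok_weight := (ok_weight eps K).
Local Notation ok_pendants := (ok_pendants eps K).
Local Notation ball_ratio := (ball_ratio K).

Lemma INR_D_ge3 : 3 <= INR D.
Proof. replace 3 with (INR 3) by (simpl; ring); now apply le_INR. Qed.

Lemma K_mul_lt1 : K * (INR D - 1) < 1.
Proof.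
  pose proof INR_D_ge3.
  apply Rlt_le_trans with (1 / (INR D - 1) * (INR D - 1)).
  - apply Rmult_lt_compat_r; lra.
  - right; field; lra.
Qed.

Lemma K_lt_half : 0 < K < 1 / 2.
Proof. pose proof INR_D_ge3; pose proof K_mul_lt1; nra. Qed.

Lemma K_mul_le1 (d : nat) : (d <= D - 1)%nat -> INR d * K <= 1.
Proof.
  intros Hd; apply le_INR in Hd; rewrite minus_INR in Hd by lia; simpl in Hd.
  pose proof K_mul_lt1; pose proof K_lt_half; nra.
Qed.

Lemma ball_ratio_sector (d : nat) (z z' : Cx) :
  ball_ratio d z z' -> exists q, sector (INR d * theta) q /\ z = Cmul q z'.
Proof.
  intros (zs & <- & Hb & E); exists (Cprod zs); split; [|assumption].
  apply Cprod_ball_sector; [pose proof K_lt_half; lra|assumption].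
Qed.

Hypothesis D_lt_k : (D < k)%nat.
Hypothesis eps_bounds : 0 < eps < 1.
Hypothesis theta_bounds : 0 < asin K < PI / (3 * (INR D - 1 + eps)).
Hypothesis main_condition : forall d : nat, (d <= D - 1)%nat ->
     let b := INR (D - d) in
     0 < (1 + eps) ^ 2 / ((INR k - b) * (1 - K) ^ d - eps * b) /\
     (1 + eps) ^ 2 / ((INR k - b) * (1 - K) ^ d - eps * b) <= K.

(** * Numerical consequences of the condition on [k], [K] and [eps] *)

Definition sum_bound (d : nat) : R :=
  (INR k - INR (D - d)) * (1 - K) ^ d - eps * INR (D - d).

Lemma sum_bound_pos (d : nat) :
  (d <= D - 1)%nat -> 0 < sum_bound d /\ (1 + eps) ^ 2 <= K * sum_bound d.
Proof.
  intros Hd; destruct (main_condition d Hd) as [H1 H2].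
  fold (sum_bound d) in H1, H2.
  assert (Ha : 0 < (1 + eps) ^ 2) by (apply pow_lt; lra).
  assert (Hf : 0 < sum_bound d).
  { destruct (Rtotal_order (sum_bound d) 0) as [H|[H|H]]; [|rewrite H in H1|assumption].
    - assert (/ sum_bound d < 0) by (now apply Rinv_lt_0_compat).
      unfold Rdiv in H1; nra.
    (* Division by 0 returns 0, so strict positivity of the quotient excludes this case as well. *)
    - unfold Rdiv in H1; rewrite Rinv_0 in H1; lra. }
  split; [assumption|].
  apply (Rmult_le_compat_r (sum_bound d)) in H2; [|lra].
  replace ((1 + eps) ^ 2 / sum_bound d * sum_bound d) with ((1 + eps) ^ 2) in H2
    by (field; lra).
  lra.
Qed.

(* Equality in the condition for [d] would violate the condition for [d + 1]. *)
Lemma sum_bound_strict (d : nat) :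
  (d <= D - 2)%nat -> (1 + eps) ^ 2 < K * sum_bound d.
Proof.
  intros Hd.
  destruct (sum_bound_pos d ltac:(lia)) as [Hp Hle].
  destruct (sum_bound_pos (S d) ltac:(lia)) as [_ Hle'].
  destruct Hle as [Hlt|E]; [assumption|exfalso].
  pose proof K_lt_half as HK.
  unfold sum_bound in *.
  rewrite minus_INR in * by lia; rewrite S_INR in Hle'; simpl pow in *.
  set (q := (1 - K) ^ d) in *.
  assert (0 < q <= 1).
  { split; [apply pow_lt; lra|].
    replace 1 with (1 ^ d) by apply pow1; apply pow_incr; lra. }
  set (x := INR k - (INR D - INR d)) in *.
  replace (INR k - (INR D - (INR d + 1))) with (x + 1) in Hle' by (unfold x; ring).
  assert (Hb : 1 <= INR D - INR d).
  { rewrite <- minus_INR by lia; replace 1 with (INR 1) by reflexivity; apply le_INR; lia. }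
  (* Passing from [d] to [d + 1] adds [q (1 - K) - K x q + eps] to [sum_bound]. Equality at [d]
     makes [K x q] exceed [(1 + eps)^2], which is more than [q (1 - K) + eps]; so [sum_bound] would
     drop below what the condition at [d + 1] demands. *)
  assert (HE : (x + 1) * ((1 - K) * q) - eps * (INR D - (INR d + 1))
      = (x * q - eps * (INR D - INR d)) + q * (1 - K) - K * (x * q) + eps) by ring.
  rewrite HE in Hle'.
  assert (K * (x * q) = (1 + eps) * ((1 + eps) * 1) + K * eps * (INR D - INR d)) by lra.
  assert (q * (1 - K) < 1) by nra.
  assert (0 < K * eps * (INR D - INR d)) by (repeat apply Rmult_lt_0_compat; lra).
  nra.
Qed.

Lemma theta_mul_lt : (INR D - 1 + eps) * theta < PI / 3.
Proof.
  pose proof INR_D_ge3.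
  apply Rlt_le_trans with ((INR D - 1 + eps) * (PI / (3 * (INR D - 1 + eps)))).
  - apply Rmult_lt_compat_l; lra.
  - right; field; lra.
Qed.

(** A free neighbour costs [theta], a pendant only [eps theta], so the worst case is [d = D - 1]
    with one pendant. This is the origin of [D - 1 + eps] in the bound on [theta]. *)
Lemma angle_lt_PI3 (d b : nat) :
  (d <= D - 1)%nat -> (b + d <= D)%nat -> INR d * theta + INR b * (eps * theta) < PI / 3.
Proof.
  intros Hd Hb; pose proof theta_mul_lt.
  apply le_INR in Hd; rewrite minus_INR in Hd by lia; simpl in Hd.
  apply le_INR in Hb; rewrite plus_INR in Hb.
  assert (INR d + INR b * eps <= INR D - 1 + eps) by nra.
  nra.
Qed.

(** For [D >= 3] one has [D <= 3 (D - 1) / 2], and [(D - 1) theta < PI / 3]. It serves a vertex with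
    all [D] neighbours free, which [angle_lt_PI3] does not cover. *)
Lemma D_theta_lt_PI2 : INR D * theta < PI / 2.
Proof. pose proof theta_mul_lt; pose proof INR_D_ge3; nra. Qed.

(** The triangle inequality for a small weight; otherwise the angle with 1 is below [PI / 3], and
    the difference is at most 1. *)
Lemma ok_weight_sub_one (z : Cx) : ok_weight z -> Cnorm (Csub z Cone) <= 1 + eps.
Proof.
  intros [H|[H H']].
  - eapply Rle_trans; [apply Cnorm_sub|]; rewrite Cnorm_one; lra.
  - apply Rle_trans with 1; [|lra].
    apply Csub_one_sector_le with (eps * theta); auto.
    pose proof (angle_lt_PI3 0 1 ltac:(lia) ltac:(lia)) as Ha; simpl in Ha; lra.
Qed.

Lemma ok_weight_le1 (z : Cx) : ok_weight z -> Cnorm z <= 1.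
Proof. intros [H|[_ H]]; lra. Qed.

Lemma act_of_le1 (P : list pendant) (u j : nat) : ok_pendants P -> Cnorm (act_of P u j) <= 1.
Proof.
  induction P as [|p P IH]; intros H; simpl; [rewrite Cnorm_one; lra|].
  rewrite Cnorm_mul.
  assert (Cnorm (act_of P u j) <= 1) by (apply IH; intros q Hq; apply H; now right).
  assert (Cnorm (pendant_factor p u j) <= 1).
  { unfold pendant_factor; destruct (_ && _); [|rewrite Cnorm_one; lra].
    apply ok_weight_le1, H; now left. }
  pose proof (Cnorm_nonneg (act_of P u j)); pose proof (Cnorm_nonneg (pendant_factor p u j)); nra.
Qed.

Lemma act_of_good (P : list pendant) (u j : nat) : pendants_col P u j = 0%nat -> act_of P u j = Cone.
Proof.
  unfold pendants_col; induction P as [|p P IH]; simpl; [reflexivity|].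
  unfold pendant_factor; destruct (_ && _); simpl; [discriminate|].
  intros H; rewrite IH by assumption; ring.
Qed.

Lemma act_of_sector (P : list pendant) (u j : nat) :
  (forall p, In p P -> fst p = u -> snd (snd p) = j -> sector (eps * theta) (fst (snd p))) ->
  sector (INR (pendants_col P u j) * (eps * theta)) (act_of P u j).
Proof.
  unfold pendants_col; induction P as [|p P IH]; intros H; simpl act_of.
  - simpl; apply sector_one; lra.
  - assert (IH' := IH (fun q Hq => H q (or_intror Hq))).
    specialize (H p (or_introl eq_refl)).
    simpl filter; unfold pendant_factor at 1.
    destruct (Nat.eqb_spec (fst p) u) as [E1|E1];
      destruct (Nat.eqb_spec j (snd (snd p))) as [E2|E2]; simpl andb; cbv iota.
    + simpl length; rewrite S_INR.
      replace ((INR (length (filter (fun p => (fst p =? u)%nat && (j =? snd (snd p))%nat) P)) + 1)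
        * (eps * theta)) with (eps * theta +
        INR (length (filter (fun p => (fst p =? u)%nat && (j =? snd (snd p))%nat) P)) * (eps * theta))
        by ring.
      apply sector_mul; auto.
    + rewrite <- (Rplus_0_l (INR _ * _)); apply sector_mul; [apply sector_one; lra|assumption].
    + rewrite <- (Rplus_0_l (INR _ * _)); apply sector_mul; [apply sector_one; lra|assumption].
    + rewrite <- (Rplus_0_l (INR _ * _)); apply sector_mul; [apply sector_one; lra|assumption].
Qed.

Lemma act_of_small (P : list pendant) (u j : nat) (p : pendant) :
  ok_pendants P -> In p P -> fst p = u -> snd (snd p) = j -> Cnorm (fst (snd p)) <= eps ->
  Cnorm (act_of P u j) <= eps.
Proof.
  intros Hok Hp Hu Hj Hs.
  apply in_split in Hp as (P1 & P2 & ->).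
  rewrite act_of_app; simpl; unfold pendant_factor at 1.
  rewrite Hu, Hj, !Nat.eqb_refl; simpl; rewrite !Cnorm_mul.
  assert (H1 : Cnorm (act_of P1 u j) <= 1)
    by (apply act_of_le1; intros q Hq; apply Hok, in_or_app; now left).
  assert (H2 : Cnorm (act_of P2 u j) <= 1)
    by (apply act_of_le1; intros q Hq; apply Hok, in_or_app; right; now right).
  pose proof (Cnorm_nonneg (act_of P1 u j)); pose proof (Cnorm_nonneg (act_of P2 u j)).
  pose proof (Cnorm_nonneg (fst (snd p))).
  assert (Cnorm (fst (snd p)) * Cnorm (act_of P2 u j) <= eps) by nra.
  assert (0 <= Cnorm (fst (snd p)) * Cnorm (act_of P2 u j)) by nra.
  nra.
Qed.

(** One small pendant of colour [j] makes the whole product small, since no factor exceeds 1 in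
    modulus. Without such a pendant the apertures add up. *)
Lemma act_of_cases (P : list pendant) (u j : nat) :
  ok_pendants P ->
  Cnorm (act_of P u j) <= eps \/
  sector (INR (pendants_col P u j) * (eps * theta)) (act_of P u j).
Proof.
  intros Hok.
  destruct (Exists_dec (fun p => fst p = u /\ snd (snd p) = j /\ Cnorm (fst (snd p)) <= eps) P)
    as [H|H].
  - intros p; destruct (Nat.eq_dec (fst p) u); [|right; tauto].
    destruct (Nat.eq_dec (snd (snd p)) j); [|right; tauto].
    destruct (Rle_dec (Cnorm (fst (snd p))) eps); [left|right]; tauto.
  - left; apply Exists_exists in H as (p & Hp & Hu & Hj & Hs).
    now apply act_of_small with p.
  - right; apply act_of_sector; intros p Hp Hu Hj.
    destruct (Hok p Hp) as [Hs|[Hs _]]; [|assumption].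
    elim H; apply Exists_exists; exists p; auto.
Qed.

(** * The sum over the colours of one vertex *)

Section Star.

(* [Y j] is the partition function of the rest of the graph once [u] has colour
   [j], without the contribution of the pendant vertices at [u]. *)
Variables (d : nat) (Y : nat -> Cx) (M u : nat).
Hypothesis Y_neq0 : forall j, In j (seq 1 k) -> Y j <> Czero.
Hypothesis Y_ratio : forall l j, In l (seq 1 k) -> In j (seq 1 k) -> ball_ratio d (Y l) (Y j).
Hypothesis M_in : In M (seq 1 k).
Hypothesis M_max : forall j, In j (seq 1 k) -> Cnorm (Y j) <= Cnorm (Y M).

Definition star_sum (P : list pendant) : Cx :=
  Csum (fun j => Cmul (act_of P u j) (Y j)) (seq 1 k).

Lemma Y_normalised (j : nat) : In j (seq 1 k) ->
  exists zs, length zs = d /\ Forall (in_ball Cone K) zs /\ Cnorm (Cprod zs) <= 1 /\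
    Y j = Cmul (Cprod zs) (Y M).
Proof.
  intros Hj; destruct (Y_ratio j M Hj M_in) as (zs & Hl & Hb & E).
  exists zs; repeat split; auto.
  pose proof (M_max j Hj) as H; rewrite E, Cnorm_mul in H.
  pose proof (Cnorm_pos _ (Y_neq0 M M_in)); nra.
Qed.

Lemma star_sum_normalised (P : list pendant) :
  star_sum P = Cmul (Csum (fun j => Cmul (act_of P u j) (Cdiv (Y j) (Y M))) (seq 1 k)) (Y M).
Proof.
  unfold star_sum; rewrite <- Csum_mul_r; apply Csum_ext; intros j Hj.
  rewrite (Cdiv_mul (Y j) (Y M)) at 1 by auto; ring.
Qed.

Lemma star_sum_lower (P : list pendant) :
  (d <= D - 1)%nat -> ok_pendants P -> (pendants_at P u + d <= D)%nat ->
  sum_bound d * Cnorm (Y M) <= Cnorm (star_sum P).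
Proof.
  intros Hd Hok HP; rewrite star_sum_normalised, Cnorm_mul.
  apply Rmult_le_compat_r; [apply Cnorm_nonneg|].
  (* A colour without pendants contributes at least [a = (1 - K)^d], any other at least [- eps], so
     a charge of [a + eps] per pendant suffices. With at most [b = D - d] pendants in total,
     [k a - (a + eps) b] is [sum_bound d]. *)
  eapply Rle_trans; [|eapply Rle_trans; [apply Rle_abs|apply Re_le_Cnorm]].
  pose proof K_lt_half as HK.
  assert (Hq : 0 < (1 - K) ^ d) by (apply pow_lt; lra).
  eapply Rle_trans; [|apply (Re_Csum_lower _ (pendants_col P u) ((1 - K) ^ d) ((1 - K) ^ d + eps))].
  - rewrite length_seq.
    pose proof (sum_pendants_col P u (seq 1 k) (seq_NoDup k 1)) as Hs.
    assert (Hs' : (list_sum (map (pendants_col P u) (seq 1 k)) <= D - d)%nat) by lia.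
    apply le_INR in Hs'.
    apply (Rmult_le_compat_l ((1 - K) ^ d + eps)) in Hs'; [|lra].
    unfold sum_bound; lra.
  - intros j Hj; destruct (Y_normalised j Hj) as (zs & Hl & Hb & Hn & E).
    rewrite (Cdiv_eq _ _ _ (Y_neq0 M M_in) E).
    destruct (Nat.eq_dec (pendants_col P u j) 0) as [Hc|Hc].
    + rewrite (act_of_good P u j Hc), Hc; simpl INR.
      replace (Cmul Cone (Cprod zs)) with (Cprod zs) by ring.
      pose proof (angle_lt_PI3 d 0 Hd ltac:(lia)) as Ha; simpl in Ha.
      pose proof PI_RGT_0.
      rewrite <- Hl, Rmult_0_r, Rminus_0_r; apply Re_Cprod_ball; auto; rewrite ?Hl; try lra.
      now apply K_mul_le1.
    + assert (1 <= INR (pendants_col P u j))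
        by (replace 1 with (INR 1) by reflexivity; apply le_INR; lia).
      apply Rle_trans with (- eps); [nra|].
      destruct (act_of_cases P u j Hok) as [Hs|Hs].
      * pose proof (Re_le_Cnorm (Cmul (act_of P u j) (Cprod zs))) as H1.
        apply Rabs_le_bounds in H1; rewrite Cnorm_mul in H1.
        pose proof (Cnorm_nonneg (act_of P u j)); pose proof (Cnorm_nonneg (Cprod zs)); nra.
      * apply Rle_trans with 0; [lra|].
        eapply sector_Re_nonneg; [|apply sector_mul; [apply Hs|]].
        2: { apply (Cprod_ball_sector K); [lra|assumption]. }
        rewrite Hl.
        pose proof (sum_pendants_col P u [j] ltac:(repeat constructor; simpl; tauto)) as Hs1.
        simpl in Hs1.
        pose proof (angle_lt_PI3 d (pendants_col P u j) Hd ltac:(lia)); pose proof PI_RGT_0; lra.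
Qed.

Lemma star_sum_neq0 (P : list pendant) :
  ok_pendants P -> (pendants_at P u + d <= D)%nat -> star_sum P <> Czero.
Proof.
  intros Hok HP E.
  pose proof (Cnorm_pos _ (Y_neq0 M M_in)) as HM.
  destruct (Nat.le_gt_cases d (D - 1)) as [Hd|Hd].
  - pose proof (star_sum_lower P Hd Hok HP) as H.
    rewrite E, Cnorm_zero in H; destruct (sum_bound_pos d Hd); nra.
  (* All [D] places are taken by free neighbours, so no pendant is left at [u], and each normalised
     term lies in a sector of aperture [D theta < PI / 2]. *)
  - assert (EdD : d = D) by lia.
    rewrite star_sum_normalised in E.
    revert E; apply Cmul_neq0; [|auto].
    intros E.
    assert (Hpos : forall l, incl l (seq 1 k) -> l <> [] ->
      0 < Re (Csum (fun j => Cmul (act_of P u j) (Cdiv (Y j) (Y M))) l)).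
    { induction l as [|j l IH]; intros Hl Hne; [contradiction|]; simpl Csum.
      assert (Hj : In j (seq 1 k)) by (apply Hl; now left).
      assert (0 < Re (Cmul (act_of P u j) (Cdiv (Y j) (Y M)))).
      { rewrite (act_of_good P u j).
        2: { pose proof (sum_pendants_col P u [j] ltac:(repeat constructor; simpl; tauto)) as H.
             simpl in H; lia. }
        destruct (Y_normalised j Hj) as (zs & Hlen & Hb & _ & Ej).
        rewrite (Cdiv_eq _ _ _ (Y_neq0 M M_in) Ej).
        replace (Cmul Cone (Cprod zs)) with (Cprod zs) by ring.
        apply sector_Re_pos with (INR (length zs) * theta).
        - rewrite Hlen, EdD; apply D_theta_lt_PI2.
        - apply Cprod_ball_sector; [pose proof K_lt_half; lra|assumption]. }
      destruct l as [|j' l].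
      - simpl in *; lra.
      - assert (0 < Re (Csum (fun j => Cmul (act_of P u j) (Cdiv (Y j) (Y M))) (j' :: l))).
        { apply IH; [intros x Hx; apply Hl; now right|discriminate]. }
        change (0 < Re (Cmul (act_of P u j) (Cdiv (Y j) (Y M)))
          + Re (Csum (fun j => Cmul (act_of P u j) (Cdiv (Y j) (Y M))) (j' :: l))); lra. }
    specialize (Hpos (seq 1 k) (incl_refl _)).
    rewrite E in Hpos; simpl in Hpos.
    assert (seq 1 k <> []) by (destruct k; [lia|discriminate]).
    specialize (Hpos ltac:(assumption)); lra.
Qed.

(** A new pendant affects only the term of its own colour. Hence the difference of two recolourings
    factors as [x - 1] times a difference of two terms. *)
Lemma star_sum_cons (P : list pendant) (x : Cx) (l : nat) :
  In l (seq 1 k) ->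
  star_sum ((u, (x, l)) :: P)
  = Cadd (star_sum P) (Cmul (Csub x Cone) (Cmul (act_of P u l) (Y l))).
Proof.
  intros Hl; unfold star_sum.
  assert (E := Csum_single (fun j => if (j =? l)%nat
    then Cmul (Csub x Cone) (Cmul (act_of P u j) (Y j)) else Czero) l (seq 1 k)).
  cbv beta in E; rewrite Nat.eqb_refl in E.
  rewrite <- E; [|apply seq_NoDup|assumption|].
  - rewrite <- Csum_add; apply Csum_ext; intros j _; simpl; unfold pendant_factor; simpl.
    rewrite Nat.eqb_refl; simpl; destruct (j =? l); ring.
  - intros i _ Hi; now apply Nat.eqb_neq in Hi as ->.
Qed.

(** If one activity is small, the triangle inequality gives [1 + eps]. Otherwise the angles of both
    activities and of the ratio of the [Y] values add up to less than [PI / 3], the two colours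
    having disjoint sets of pendants, and the difference is at most the larger modulus. *)
Lemma act_of_Y_diff (P : list pendant) (l l' : nat) :
  ok_pendants P -> (S (pendants_at P u) + d <= D)%nat -> l <> l' ->
  In l (seq 1 k) -> In l' (seq 1 k) ->
  Cnorm (Csub (Cmul (act_of P u l) (Y l)) (Cmul (act_of P u l') (Y l')))
    <= (1 + eps) * Cnorm (Y M).
Proof.
  intros Hok HP Hne Hl Hl'.
  pose proof (Cnorm_pos _ (Y_neq0 M M_in)) as HM.
  pose proof (M_max l Hl) as Ml; pose proof (M_max l' Hl') as Ml'.
  pose proof (act_of_le1 P u l Hok) as Al; pose proof (act_of_le1 P u l' Hok) as Al'.
  pose proof (Cnorm_nonneg (act_of P u l)); pose proof (Cnorm_nonneg (act_of P u l')).
  pose proof (Cnorm_nonneg (Y l)); pose proof (Cnorm_nonneg (Y l')).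
  destruct (act_of_cases P u l Hok) as [Hs|Hs].
  { eapply Rle_trans; [apply Cnorm_sub|]; rewrite !Cnorm_mul; nra. }
  destruct (act_of_cases P u l' Hok) as [Hs'|Hs'].
  { eapply Rle_trans; [apply Cnorm_sub|]; rewrite !Cnorm_mul; nra. }
  apply Rle_trans with (Cnorm (Y M)); [|nra].
  destruct (ball_ratio_sector _ _ _ (Y_ratio l l' Hl Hl')) as (q & Hq & Eq).
  destruct (sector_quotient _ _ _ _ Hs Hs') as (q' & Hq' & Eq').
  assert (E : Cmul (act_of P u l) (Y l) = Cmul (Cmul q' q) (Cmul (act_of P u l') (Y l')))
    by (rewrite Eq, Eq'; ring).
  assert (Hn : Cnorm (Cmul (act_of P u l) (Y l)) <= Cnorm (Y M)) by (rewrite Cnorm_mul; nra).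
  rewrite E in Hn |- *.
  eapply Csub_sector_le; [|apply sector_mul; [apply Hq'|apply Hq]| |assumption].
  - pose proof (pendants_col_pair P u l l' Hne) as Hc.
    pose proof (angle_lt_PI3 d (pendants_col P u l + pendants_col P u l') ltac:(lia) ltac:(lia)) as Ha.
    rewrite plus_INR in Ha; lra.
  - rewrite Cnorm_mul; nra.
Qed.

Lemma star_sum_recolour (P : list pendant) (x : Cx) (l l' : nat) :
  ok_pendants P -> ok_weight x -> (S (pendants_at P u) + d <= D)%nat ->
  In l (seq 1 k) -> In l' (seq 1 k) ->
  Cnorm (Csub (star_sum ((u, (x, l)) :: P)) (star_sum ((u, (x, l')) :: P)))
    < K * Cnorm (star_sum ((u, (x, l')) :: P)).
Proof.
  intros Hok Hx HP Hl Hl'.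
  assert (Hd : (d <= D - 1)%nat) by lia.
  pose proof (Cnorm_pos _ (Y_neq0 M M_in)) as HM.
  pose proof K_lt_half as HK.
  assert (HZ : sum_bound d * Cnorm (Y M) <= Cnorm (star_sum ((u, (x, l')) :: P))).
  { apply star_sum_lower; auto.
    - intros p [<-|Hp]; [assumption|now apply Hok].
    - unfold pendants_at in *; simpl; rewrite Nat.eqb_refl; simpl; lia. }
  destruct (sum_bound_pos d Hd) as [Hpos Hle].
  destruct (Nat.eq_dec l l') as [->|Hne].
  { replace (Csub _ _) with Czero by ring; rewrite Cnorm_zero; nra. }
  pose proof (ok_weight_sub_one x Hx) as Hx1; pose proof (Cnorm_nonneg (Csub x Cone)).
  set (A := Csub (Cmul (act_of P u l) (Y l)) (Cmul (act_of P u l') (Y l'))).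
  assert (HA : Cnorm A <= (1 + eps) * Cnorm (Y M)) by (now apply act_of_Y_diff).
  replace (Csub (star_sum ((u, (x, l)) :: P)) (star_sum ((u, (x, l')) :: P)))
    with (Cmul (Csub x Cone) A) by (rewrite !star_sum_cons by assumption; unfold A; ring).
  rewrite Cnorm_mul; pose proof (Cnorm_nonneg A).
  assert (HB : Cnorm (Csub x Cone) * Cnorm A <= (1 + eps) * Cnorm A) by nra.
  (* Strictness has two sources. For [d <= D - 2] the numerical condition itself is strict. For
     [d = D - 1] the recoloured pendant is the only one at [u], so all activities from [P] are 1 and
     [A] is a difference [Y l - Y l'], strictly below [|Y M|]. *)
  destruct (Nat.le_gt_cases d (D - 2)) as [Hd2|Hd2].
  - pose proof (sum_bound_strict d Hd2); simpl in *.
    apply Rle_lt_trans with ((1 + eps) * ((1 + eps) * Cnorm (Y M))); [nra|].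
    apply Rlt_le_trans with (K * (sum_bound d * Cnorm (Y M))); nra.
  - assert (HA' : Cnorm A < (1 + eps) * Cnorm (Y M)).
    { apply Rlt_le_trans with (Cnorm (Y M)); [|nra].
      assert (Hc : forall j, act_of P u j = Cone).
      { intros j; apply act_of_good.
        pose proof (sum_pendants_col P u [j] ltac:(repeat constructor; simpl; tauto)) as Hs.
        simpl in Hs; lia. }
      unfold A; rewrite !Hc.
      destruct (ball_ratio_sector _ _ _ (Y_ratio l l' Hl Hl')) as (q & Hq & Eq).
      replace (Csub (Cmul Cone (Y l)) (Cmul Cone (Y l'))) with (Csub (Cmul q (Y l')) (Y l'))
        by (rewrite <- Eq; ring).
      apply Csub_sector_lt with (INR d * theta); auto.
      - pose proof (angle_lt_PI3 d 0 Hd ltac:(lia)) as Ha; simpl in Ha; lra.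
      - rewrite <- Eq; auto. }
    simpl in Hle.
    apply Rlt_le_trans with ((1 + eps) * ((1 + eps) * Cnorm (Y M))); [nra|].
    apply Rle_trans with (K * (sum_bound d * Cnorm (Y M))); nra.
Qed.

End Star.

(** * Simultaneous induction for nonvanishing and recolouring *)

Variables (adj : nat -> nat -> bool) (w : nat -> nat -> Cx).
Hypothesis adj_sym : forall u v, adj u v = adj v u.
Hypothesis adj_irrefl : forall u, adj u u = false.
Hypothesis w_sym : forall u v, w u v = w v u.
Hypothesis w_ok : forall u v, adj u v = true -> ok_weight (w u v).

Local Notation Z := (Zact k adj w).
Local Notation admissible := (admissible D eps K adj).
Local Notation nonvanishing := (nonvanishing D k eps K adj w).
Local Notation recolourable := (recolourable D k eps K adj w).

Lemma Zact_cons_star (S : list nat) (u : nat) (P : list pendant) :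
  NoDup S -> Z (u :: S) (act_of P)
    = star_sum (fun j => Z S (act_of (pendants_of adj w u j S ++ P))) u P.
Proof.
  intros Hd; unfold star_sum; simpl; apply Csum_ext; intros l _.
  now rewrite Zact_pin_act_of.
Qed.

(** Both properties must be carried together: removing [u] from [S], each of them needs nonzero [Y]
    values and control of their ratios on the smaller set. [P] is quantified inside both, because an
    elimination changes the pendants. *)
Lemma zero_freeness (S : list nat) : nonvanishing S /\ recolourable S.
Proof.
  remember (length S) as n eqn:En; revert S En.
  induction n as [|n IH]; intros S En.
  - symmetry in En; apply length_zero_iff_nil in En as ->; split.
    + intros P _; simpl; intros E; injection E; lra.
    + intros P1 P2 v x l l' [].
  - assert (Hk : seq 1 k <> []) by (destruct k; [lia|discriminate]).
    assert (Hstar : forall u S' P, length S' = n -> admissible (u :: S') P ->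
      let Y := fun j => Z S' (act_of (pendants_of adj w u j S' ++ P)) in
      (forall j, In j (seq 1 k) -> Y j <> Czero) /\
      (forall l j, In l (seq 1 k) -> In j (seq 1 k) ->
        ball_ratio (length (filter (adj u) S')) (Y l) (Y j)) /\
      (pendants_at P u + length (filter (adj u) S') <= D)%nat).
    { intros u S' P HS' Hadm; destruct (IH S' (eq_sym HS')) as [HA HB].
      repeat split.
      - intros j Hj; now apply HA, admissible_pin.
      - intros l j Hl Hj; now apply (recolour_neighbours D k eps K).
      - destruct Hadm as (_ & _ & Hdeg); specialize (Hdeg u (or_introl eq_refl)).
        simpl in Hdeg; rewrite adj_irrefl in Hdeg; lia. }
    split.
    + intros P Hadm; destruct S as [|u S']; [discriminate|]; injection En as En.
      destruct (Hstar u S' P (eq_sym En) Hadm) as (HY & HR & Hdeg).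
      destruct Hadm as (Hd & Hok & _); apply NoDup_cons_iff in Hd as [_ Hd].
      rewrite Zact_cons_star by assumption.
      match goal with |- star_sum ?Y _ _ <> _ =>
        destruct (list_argmax (fun j => Cnorm (Y j)) (seq 1 k) Hk) as (M & HM & Hmax) end.
      now apply (star_sum_neq0 (length (filter (adj u) S')) _ M).
    + intros P1 P2 u x l l' Hu Hl Hl' Hadm.
      apply in_split in Hu as (S1 & S2 & ->).
      assert (Hp : Permutation (S1 ++ u :: S2) (u :: S1 ++ S2))
        by (apply Permutation_sym, Permutation_middle).
      rewrite !(Zact_perm k adj w adj_sym w_sym _ _ _ Hp).
      apply (admissible_perm _ _ _ _ _ _ _ Hp) in Hadm.
      assert (HlenS : length (S1 ++ S2) = n)
        by (rewrite length_app in *; simpl in En; lia).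
      set (S' := S1 ++ S2) in *; clearbody S'; clear Hp En S1 S2.
      pose proof Hadm as (Hd & Hok & Hdeg0); apply NoDup_cons_iff in Hd as [Hu Hd].
      (* The recoloured pendant acts on [u] alone, so the values [Y j] are the same before and after
         recolouring. *)
      assert (Hact : forall c v, In v S' ->
        forall a, act_of (P1 ++ (u, (x, c)) :: P2) v a = act_of (P1 ++ P2) v a).
      { intros c v Hv a; rewrite !act_of_app; simpl; unfold pendant_factor at 1; simpl.
        assert (E : u <> v) by congruence; apply Nat.eqb_neq in E as ->; simpl; ring. }
      assert (Hat : pendants_at (P1 ++ (u, (x, l)) :: P2) u = S (pendants_at (P1 ++ P2) u)).
      { rewrite !pendants_at_app; unfold pendants_at; simpl.
        rewrite Nat.eqb_refl; simpl; lia. }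
      assert (Hadm0 : admissible (u :: S') (P1 ++ P2)).
      { repeat split; [now constructor| |].
        - intros p Hp; apply Hok; apply in_app_or in Hp as [Hp|Hp]; apply in_or_app;
            [now left|right; now right].
        - intros v Hv; specialize (Hdeg0 v Hv); revert Hdeg0; rewrite !pendants_at_app.
          unfold pendants_at; simpl; destruct (u =? v); simpl; lia. }
      destruct (Hstar u S' (P1 ++ P2) HlenS Hadm0) as (HY & HR & _).
      set (Y := fun j => Z S' (act_of (pendants_of adj w u j S' ++ P1 ++ P2))) in *.
      assert (HZ : forall c, Z (u :: S') (act_of (P1 ++ (u, (x, c)) :: P2))
        = star_sum Y u ((u, (x, c)) :: P1 ++ P2)).
      { intros c; rewrite Zact_cons_star by assumption.
        apply Csum_ext; intros j _; f_equal.
        - simpl; rewrite !act_of_app; simpl; ring.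
        - apply Zact_ext; intros v a Hv _.
          now rewrite !(act_of_app (pendants_of _ _ _ _ _)), Hact. }
      rewrite !HZ.
      destruct (list_argmax (fun j => Cnorm (Y j)) (seq 1 k) Hk) as (M & HM & Hmax).
      apply (star_sum_recolour (length (filter (adj u) S')) Y M); auto.
      * now destruct Hadm0 as (_ & Hok0 & _).
      * apply (Hok (u, (x, l))), in_or_app; right; now left.
      * rewrite <- Hat; specialize (Hdeg0 u (or_introl eq_refl)); simpl in Hdeg0.
        rewrite adj_irrefl in Hdeg0; lia.
Qed.

End Induction.

(** * From colourings to activities *)

Definition Cprodf {A : Type} (f : A -> Cx) (l : list A) : Cx :=
  fold_right (fun x acc => Cmul (f x) acc) Cone l.

Lemma Cprodf_ext {A : Type} (f g : A -> Cx) (l : list A) :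
  (forall x, In x l -> f x = g x) -> Cprodf f l = Cprodf g l.
Proof.
  induction l as [|x l IH]; intros H; [reflexivity|]; simpl.
  rewrite (H x) by (now left); rewrite IH; [reflexivity|].
  intros; apply H; now right.
Qed.

Lemma Cprodf_app {A : Type} (f : A -> Cx) (l l' : list A) :
  Cprodf f (l ++ l') = Cmul (Cprodf f l) (Cprodf f l').
Proof. induction l as [|x l IH]; simpl; [ring|]; rewrite IH; ring. Qed.

Lemma Cprodf_mul {A : Type} (f g : A -> Cx) (l : list A) :
  Cprodf (fun x => Cmul (f x) (g x)) l = Cmul (Cprodf f l) (Cprodf g l).
Proof. induction l as [|x l IH]; simpl; [ring|]; rewrite IH; ring. Qed.

Lemma Cprodf_one {A : Type} (l : list A) : Cprodf (fun _ => Cone) l = Cone.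
Proof. induction l as [|x l IH]; simpl; [reflexivity|]; rewrite IH; ring. Qed.

Lemma Cprodf_rev {A : Type} (f : A -> Cx) (l : list A) : Cprodf f (rev l) = Cprodf f l.
Proof. induction l as [|x l IH]; simpl; [reflexivity|]; rewrite Cprodf_app, IH; simpl; ring. Qed.

Lemma Csum_app {A : Type} (f : A -> Cx) (l l' : list A) :
  Csum f (l ++ l') = Cadd (Csum f l) (Csum f l').
Proof. induction l as [|x l IH]; simpl; [ring|]; rewrite IH; ring. Qed.

Lemma Csum_flat_map {A B : Type} (f : B -> Cx) (g : A -> list B) (l : list A) :
  Csum f (flat_map g l) = Csum (fun x => Csum f (g x)) l.
Proof. induction l as [|x l IH]; simpl; [reflexivity|]; now rewrite Csum_app, IH. Qed.

Lemma Csum_map {A B : Type} (f : B -> Cx) (g : A -> B) (l : list A) :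
  Csum f (map g l) = Csum (fun x => f (g x)) l.
Proof. induction l as [|x l IH]; simpl; [reflexivity|]; now rewrite IH. Qed.

Lemma colourings_length (n k : nat) (c : list nat) : In c (colourings n k) -> length c = n.
Proof.
  revert c; induction n as [|n IH]; intros c H; simpl in H.
  - now destruct H as [<-|[]].
  - apply in_flat_map in H as (c' & Hc' & H); apply in_map_iff in H as (l & <- & _).
    simpl; now rewrite IH.
Qed.

Lemma col_cons_last (l : nat) (c : list nat) : col (l :: c) (length c) = l.
Proof.
  unfold col; simpl; rewrite app_nth2; rewrite length_rev; [now rewrite Nat.sub_diag|lia].
Qed.

Lemma col_cons_lt (l i : nat) (c : list nat) : (i < length c)%nat -> col (l :: c) i = col c i.
Proof. intros H; unfold col; simpl; rewrite app_nth1; [reflexivity|]; now rewrite length_rev. Qed.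

Lemma rev_seq_S (n : nat) : rev (seq 0 (S n)) = n :: rev (seq 0 n).
Proof. rewrite seq_S, rev_unit; reflexivity. Qed.

Lemma in_rev_seq (i n : nat) : In i (rev (seq 0 n)) -> (i < n)%nat.
Proof. intros H; apply in_rev, in_seq in H; lia. Qed.

Section Link.

Variables (k n : nat) (adj : nat -> nat -> bool) (w : nat -> nat -> Cx).
Hypothesis graph : simple_graph n adj.
Hypothesis w_sym : forall u v, w u v = w v u.

Local Notation Z := (Zact k adj w).
Local Notation ef := (edge_factor adj w).

(** The summand of the expanded [Zact] that belongs to the colouring [phi]. *)
Fixpoint colouring_weight (S : list nat) (phi : nat -> nat) (act : nat -> nat -> Cx) : Cx :=
  match S with
  | [] => Cone
  | u :: S' => Cmul (act u (phi u)) (colouring_weight S' phi (pin adj w act u (phi u)))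
  end.

Lemma colouring_weight_ext (S : list nat) (phi psi : nat -> nat) (act : nat -> nat -> Cx) :
  (forall v, In v S -> phi v = psi v) -> colouring_weight S phi act = colouring_weight S psi act.
Proof.
  revert act; induction S as [|u S IH]; intros act H; [reflexivity|]; simpl.
  rewrite (H u (or_introl eq_refl)), IH; [reflexivity|].
  intros v Hv; apply H; now right.
Qed.

(** The head of a list in [colourings (S m) k] is the colour of vertex [m], so the matching
    elimination order runs from the last vertex down. *)
Lemma Zact_colourings (m : nat) (act : nat -> nat -> Cx) :
  Z (rev (seq 0 m)) act
  = Csum (fun c => colouring_weight (rev (seq 0 m)) (col c) act) (colourings m k).
Proof.
  revert act; induction m as [|m IH]; intros act; [simpl; ring|].
  rewrite rev_seq_S; simpl colourings; rewrite Csum_flat_map.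
  cbn [Zact].
  rewrite (Csum_ext (fun c => Csum _ (map _ _)) (fun c => Csum (fun l =>
    Cmul (act m l) (colouring_weight (rev (seq 0 m)) (col c) (pin adj w act m l))) (seq 1 k))).
  - rewrite Csum_swap; apply Csum_ext; intros l _; now rewrite Csum_mul_l, IH.
  - intros c Hc; apply colourings_length in Hc; rewrite Csum_map.
    apply Csum_ext; intros l _; cbn [colouring_weight].
    replace (col (l :: c) m) with l by (rewrite <- Hc; now rewrite col_cons_last).
    f_equal; apply colouring_weight_ext; intros v Hv; apply in_rev_seq in Hv.
    apply col_cons_lt; lia.
Qed.

Fixpoint pair_weight (S : list nat) (phi : nat -> nat) : Cx :=
  match S with
  | [] => Cone
  | u :: S' => Cmul (Cprodf (fun v => ef u (phi u) v (phi v)) S') (pair_weight S' phi)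
  end.

Lemma colouring_weight_factor (S : list nat) (phi : nat -> nat) (act : nat -> nat -> Cx) :
  colouring_weight S phi act = Cmul (Cprodf (fun u => act u (phi u)) S) (pair_weight S phi).
Proof.
  revert act; induction S as [|u S IH]; intros act; simpl; [ring|].
  rewrite IH; unfold pin at 1; rewrite Cprodf_mul; ring.
Qed.

Lemma weight_double_prod (c : list nat) :
  weight n adj w c
  = Cprodf (fun u => Cprodf (fun v => if u <? v then ef u (col c u) v (col c v) else Cone)
      (seq 0 n)) (seq 0 n).
Proof.
  unfold weight, edges.
  generalize (seq 0 n) at 2 4; intros l; induction l as [|u l IH]; [reflexivity|]; simpl.
  rewrite fold_right_app, IH; clear IH.
  set (z := Cprodf _ l); clearbody z.
  induction (seq 0 n) as [|v m IH]; simpl; [ring|].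
  unfold edge_factor at 1; rewrite (Nat.eqb_sym (col c v)).
  destruct (u <? v); simpl; [|rewrite IH; ring].
  destruct (adj u v); simpl; [|rewrite IH; ring].
  destruct (col c u =? col c v); rewrite IH; ring.
Qed.

Lemma weight_pair_weight (c : list nat) :
  weight n adj w c = pair_weight (rev (seq 0 n)) (col c).
Proof.
  destruct graph as (adj_sym & _ & _).
  rewrite weight_double_prod; clear graph.
  induction n as [|m IH]; [reflexivity|].
  rewrite rev_seq_S; simpl pair_weight; rewrite <- IH.
  rewrite seq_S, Cprodf_app; simpl Nat.add; cbn [Cprodf fold_right].
  (* Row [m] is trivial, since [m < v] fails for all [v <= m]. Each earlier row gains the entry in
     column [m], and these are the factors that [pair_weight] collects at its head. *)
  rewrite (Cprodf_ext (fun v => if m <? v then _ else _) (fun _ => Cone) (seq 0 m ++ [m])).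
  2: { intros v Hv; apply in_app_or in Hv.
       assert ((m <? v) = false) as ->; [|reflexivity].
       apply Nat.ltb_ge; destruct Hv as [Hv|[<-|[]]]; [apply in_seq in Hv|]; lia. }
  rewrite Cprodf_one.
  rewrite (Cprodf_ext (fun u => Cprodf _ (seq 0 m ++ [m]))
    (fun u => Cmul (Cprodf (fun v => if u <? v then ef u (col c u) v (col c v) else Cone) (seq 0 m))
                   (ef m (col c m) u (col c u)))).
  - rewrite Cprodf_mul, Cprodf_rev; ring.
  - intros u Hu; apply in_seq in Hu.
    rewrite Cprodf_app; simpl.
    assert ((u <? m) = true) as -> by (apply Nat.ltb_lt; lia).
    rewrite (edge_factor_sym adj w adj_sym w_sym m); ring.
Qed.

(* Hard constraints as 0/1 activities. *)
Definition act0 (W L : list nat) (v c : nat) : Cx :=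
  if forallb (fun p => negb (fst p =? v) || (c =? snd p)) (combine W L) then Cone else Czero.

Lemma Cprodf_act0 (W L S : list nat) (phi : nat -> nat) :
  Cprodf (fun u => act0 W L u (phi u)) S =
  if forallb (fun u => forallb (fun p => negb (fst p =? u) || (phi u =? snd p)) (combine W L)) S
  then Cone else Czero.
Proof.
  induction S as [|u S IH]; [reflexivity|]; simpl; rewrite IH; unfold act0.
  destruct (forallb _ (combine W L)); simpl; [|ring].
  destruct (forallb _ S); ring.
Qed.

(** [respects] tests every listed constraint, the activities only those at vertices being summed
    over; the two agree because [W] lies below [n]. *)
Lemma Zpart_act0 (W L : list nat) :
  (forall x, In x W -> (x < n)%nat) -> Zpart k n adj w W L = Z (seq 0 n) (act0 W L).
Proof.
  intros HW; destruct graph as (adj_sym & _ & _).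
  rewrite (Zact_perm k adj w adj_sym w_sym (seq 0 n) (rev (seq 0 n))) by apply Permutation_rev.
  rewrite Zact_colourings; unfold Zpart.
  assert (H : forall c, colouring_weight (rev (seq 0 n)) (col c) (act0 W L)
    = if respects c W L then weight n adj w c else Czero).
  { intros c; rewrite colouring_weight_factor, Cprodf_act0, weight_pair_weight.
    replace (respects c W L) with (forallb (fun u => forallb (fun p =>
      negb (fst p =? u) || (col c u =? snd p)) (combine W L)) (rev (seq 0 n))).
    - destruct (forallb _ _); ring.
    - apply eq_true_iff_eq; unfold respects; rewrite !forallb_forall; split.
      + intros H [x l] Hp; simpl.
        pose proof (in_combine_l _ _ _ _ Hp) as Hx; apply HW in Hx.
        specialize (H x); rewrite forallb_forall in H.
        specialize (H ltac:(apply -> in_rev; apply in_seq; lia) (x, l) Hp); simpl in H.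
        now rewrite Nat.eqb_refl in H.
      + intros H u _; apply forallb_forall; intros p Hp; specialize (H p Hp).
        destruct (Nat.eqb_spec (fst p) u) as [<-|]; [simpl; assumption|reflexivity]. }
  induction (colourings n k) as [|c cs IH]; [reflexivity|]; simpl.
  rewrite <- IH, H; destruct (respects c W L); ring.
Qed.

(** * Elimination of the fixed vertices *)

Lemma combine_functional (W L : list nat) (x l l' : nat) :
  NoDup W -> In (x, l) (combine W L) -> In (x, l') (combine W L) -> l = l'.
Proof.
  revert L; induction W as [|y W IH]; intros [|m L] Hd H H'; try now elim H.
  apply NoDup_cons_iff in Hd as [Hy Hd].
  destruct H as [E|H], H' as [E'|H'].
  - congruence.
  - injection E as -> _; elim Hy; now apply in_combine_l in H'.
  - injection E' as -> _; elim Hy; now apply in_combine_l in H.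
  - now apply (IH L).
Qed.

Lemma act0_in (W L : list nat) (x l c : nat) :
  NoDup W -> In (x, l) (combine W L) -> act0 W L x c = if c =? l then Cone else Czero.
Proof.
  intros Hd Hx; unfold act0.
  replace (forallb _ _) with (c =? l); [reflexivity|].
  apply eq_true_iff_eq; rewrite forallb_forall, Nat.eqb_eq; split.
  - intros -> [y m] Hy; simpl; destruct (Nat.eqb_spec y x) as [->|]; [|reflexivity]; simpl.
    apply Nat.eqb_eq; now apply (combine_functional W L x).
  - intros H; specialize (H _ Hx); simpl in H; rewrite Nat.eqb_refl in H.
    now apply Nat.eqb_eq in H.
Qed.

Lemma act0_out (W L : list nat) (x c : nat) : ~ In x W -> act0 W L x c = Cone.
Proof.
  intros H; unfold act0.
  replace (forallb _ _) with true; [reflexivity|]; symmetry.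
  apply forallb_forall; intros [y m] Hy; simpl.
  apply in_combine_l in Hy; destruct (Nat.eqb_spec y x) as [->|]; [contradiction|reflexivity].
Qed.

Definition all_pendants (W L S : list nat) : list pendant :=
  flat_map (fun p => pendants_of adj w (fst p) (snd p) S) (combine W L).

(** Independence of [W] means that pinning one of its vertices leaves the 0/1 activities of the
    others intact. Each sum over a fixed vertex therefore collapses to one colour and leaves only
    pendants on [S]. *)
Lemma Zact_pin_all (W L S : list nat) (act : nat -> nat -> Cx) :
  NoDup S -> (forall x y, In x W -> In y W -> adj x y = false) ->
  colour_list k L -> length L = length W ->
  (forall x l c, In (x, l) (combine W L) -> act x c = if c =? l then Cone else Czero) ->
  Z (W ++ S) act = Z S (fun v c => Cmul (act_of (all_pendants W L S) v c) (act v c)).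
Proof.
  intros HS; revert L act; induction W as [|x W IH]; intros [|l L] act HW HL Hlen Hact;
    try discriminate.
  - apply Zact_ext; intros; simpl; ring.
  - inversion_clear HL as [|? ? Hl HL'].
    assert (Hx := fun c => Hact x l c (or_introl eq_refl)).
    simpl app; rewrite (Zact_pinned k adj w x l).
    + rewrite (IH L); auto.
      * rewrite Hx, Nat.eqb_refl.
        match goal with |- Cmul Cone ?z = _ => replace (Cmul Cone z) with z by ring end.
        apply Zact_ext; intros v c Hv _; unfold all_pendants; simpl.
        rewrite act_of_app, act_of_pendants by assumption; unfold pin; ring.
      * intros y y' Hy Hy'; apply HW; now right.
      * intros y m c Hy; unfold pin, edge_factor.
        pose proof (in_combine_l _ _ _ _ Hy).
        rewrite HW by (now left + now right); simpl.
        rewrite (Hact y m c (or_intror Hy)); ring.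
    + apply in_seq; lia.
    + intros c _ Hc; rewrite Hx; now apply Nat.eqb_neq in Hc as ->.
Qed.

Lemma Zpart_free (W L S : list nat) :
  NoDup W -> (forall x y, In x W -> In y W -> adj x y = false) ->
  colour_list k L -> length L = length W -> Permutation (W ++ S) (seq 0 n) ->
  Zpart k n adj w W L = Z S (act_of (all_pendants W L S)).
Proof.
  intros Hd HW HL Hlen Hp; destruct graph as (adj_sym & _ & _).
  assert (HdS : NoDup (W ++ S)) by (apply Permutation_NoDup with (seq 0 n);
    [now apply Permutation_sym|apply seq_NoDup]).
  rewrite Zpart_act0.
  - rewrite <- (Zact_perm k adj w adj_sym w_sym _ _ _ Hp).
    rewrite Zact_pin_all with (L := L); auto.
    + apply Zact_ext; intros v c Hv _; rewrite act0_out; [ring|].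
      intros Hv'; apply in_split in Hv' as (W1 & W2 & ->).
      rewrite <- app_assoc in HdS; apply NoDup_remove_2 in HdS.
      apply HdS; rewrite !in_app_iff; tauto.
    + now apply NoDup_app_remove_l in HdS.
    + intros; now apply act0_in.
  - intros x Hx; assert (In x (seq 0 n)) as Hx'.
    { apply Permutation_in with (W ++ S); [assumption|apply in_or_app; now left]. }
    apply in_seq in Hx'; lia.
Qed.

Lemma combine_snoc (W L : list nat) (u l : nat) :
  length L = length W -> combine (W ++ [u]) (L ++ [l]) = combine W L ++ [(u, l)].
Proof.
  revert L; induction W as [|x W IH]; intros [|m L] H; try discriminate; [reflexivity|].
  simpl; rewrite IH; [reflexivity|]; now injection H.
Qed.

(** The form required for (C), where [u] may be adjacent to [W]. Eliminated after [W], it has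
    received pendants from its fixed neighbours, and its own fixed colour turns them into the factor
    [act_of P u l]. *)
Lemma Zpart_pinned (W L S : list nat) (u l : nat) :
  (forall x y, In x W -> In y W -> adj x y = false) ->
  colour_list k L -> (1 <= l <= k)%nat -> length L = length W ->
  Permutation (W ++ u :: S) (seq 0 n) ->
  let P := all_pendants W L (u :: S) in
  Zpart k n adj w (W ++ [u]) (L ++ [l])
  = Cmul (act_of P u l) (Z S (act_of (pendants_of adj w u l S ++ P))).
Proof.
  intros HW HL Hl Hlen Hp P; destruct graph as (adj_sym & _ & _).
  assert (HdS : NoDup (W ++ u :: S)) by (apply Permutation_NoDup with (seq 0 n);
    [now apply Permutation_sym|apply seq_NoDup]).
  assert (Hd : NoDup (W ++ [u])).
  { apply NoDup_app_remove_r with S; now rewrite <- app_assoc. }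
  pose proof (NoDup_app_remove_l _ _ HdS) as HdS'.
  pose proof (proj1 (NoDup_cons_iff _ _) HdS') as [HuS HS].
  rewrite Zpart_act0.
  - rewrite <- (Zact_perm k adj w adj_sym w_sym _ _ _ Hp).
    rewrite Zact_pin_all with (L := L); auto.
    + assert (Hu : forall c, act0 (W ++ [u]) (L ++ [l]) u c = if c =? l then Cone else Czero).
      { intros c; apply act0_in; [assumption|].
        rewrite combine_snoc by assumption; apply in_or_app; right; now left. }
      rewrite (Zact_pinned k adj w u l).
      * rewrite Hu, Nat.eqb_refl; fold P.
        replace (Cmul (act_of P u l) Cone) with (act_of P u l) by ring; f_equal.
        rewrite <- Zact_pin_act_of by assumption.
        apply Zact_ext; intros v c Hv _; unfold pin; f_equal.
        rewrite act0_out; [ring|].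
        intros Hv'; apply in_app_or in Hv' as [Hv'|[->|[]]]; [|contradiction].
        apply in_split in Hv' as (W1 & W2 & ->).
        rewrite <- app_assoc in HdS; apply NoDup_remove_2 in HdS.
        apply HdS; rewrite !in_app_iff; simpl; tauto.
      * apply in_seq; lia.
      * intros c _ Hc; rewrite Hu; apply Nat.eqb_neq in Hc as ->; ring.
    + intros x m c Hx; apply act0_in; [assumption|].
      rewrite combine_snoc by assumption; apply in_or_app; now left.
  - intros x Hx; assert (In x (seq 0 n)) as Hx'.
    { apply Permutation_in with (W ++ u :: S); [assumption|].
      apply in_app_or in Hx as [Hx|[<-|[]]]; apply in_or_app; [now left|right; now left]. }
    apply in_seq in Hx'; lia.
Qed.

Lemma pendants_at_all (W L S : list nat) (v : nat) :
  NoDup S -> In v S -> length L = length W ->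
  pendants_at (all_pendants W L S) v = length (filter (adj v) W).
Proof.
  intros HS Hv; destruct graph as (adj_sym & _ & _).
  revert L; induction W as [|x W IH]; intros [|l L] H; try discriminate; [reflexivity|].
  unfold all_pendants in *; simpl.
  rewrite pendants_at_app, pendants_at_pendants_of, IH by (auto; now injection H).
  rewrite adj_sym; now destruct (adj v x).
Qed.

Definition rest (W : list nat) : list nat :=
  filter (fun v => negb (existsb (Nat.eqb v) W)) (seq 0 n).

Lemma in_rest (W : list nat) (v : nat) : In v (rest W) <-> (v < n)%nat /\ ~ In v W.
Proof.
  unfold rest; rewrite filter_In, in_seq, negb_true_iff.
  assert (existsb (Nat.eqb v) W = false <-> ~ In v W).
  { rewrite <- not_true_iff_false, existsb_exists; split; intros H.
    - intros Hv; apply H; exists v; split; [assumption|apply Nat.eqb_refl].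
    - intros (y & Hy & E); apply Nat.eqb_eq in E as ->; contradiction. }
  intuition lia.
Qed.

Lemma perm_rest (W : list nat) :
  NoDup W -> (forall x, In x W -> (x < n)%nat) -> Permutation (W ++ rest W) (seq 0 n).
Proof.
  intros Hd HW; apply NoDup_Permutation.
  - apply NoDup_app; [assumption|apply NoDup_filter, seq_NoDup|].
    intros x Hx Hx'; apply in_rest in Hx' as [_ Hx']; contradiction.
  - apply seq_NoDup.
  - intros x; rewrite in_app_iff, in_rest, in_seq; split.
    + intros [H|[H _]]; [specialize (HW x H)|]; lia.
    + intros H; destruct (in_dec Nat.eq_dec x W); [now left|right; split; [lia|assumption]].
Qed.

(** Counting [u] itself among the fixed vertices changes nothing, since [u] is not its own
    neighbour. *)
Lemma free_degree_rest (W : list nat) (u : nat) :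
  free_degree n adj W u = length (filter (adj u) (rest (W ++ [u]))).
Proof.
  destruct graph as (_ & adj_irrefl & _).
  unfold free_degree, neighbours, rest; f_equal.
  induction (seq 0 n) as [|v l IH]; [reflexivity|]; simpl.
  rewrite existsb_app; simpl; rewrite orb_false_r.
  destruct (Nat.eqb_spec v u) as [->|Hne].
  - rewrite adj_irrefl, orb_true_r; simpl; assumption.
  - rewrite orb_false_r; destruct (adj u v) eqn:E; simpl;
      destruct (existsb (Nat.eqb v) W); simpl; rewrite ?E, IH; reflexivity.
Qed.

Lemma in_all_pendants (W L S : list nat) (p : pendant) :
  In p (all_pendants W L S) ->
  exists x, In (x, snd (snd p)) (combine W L) /\ In (fst p) S /\ adj x (fst p) = true /\
    fst (snd p) = w x (fst p).
Proof.
  intros H; apply in_flat_map in H as ([x l] & Hx & H).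
  apply in_map_iff in H as (v & <- & Hv); apply filter_In in Hv as [Hv Ha].
  exists x; auto.
Qed.

Lemma in_combine_nth (W L : list nat) (x l : nat) :
  length L = length W -> In (x, l) (combine W L) ->
  exists i, (i < length W)%nat /\ nth i W 0%nat = x /\ nth i L 0%nat = l.
Proof.
  intros Hlen H; apply (In_nth _ _ (0, 0)%nat) in H as (i & Hi & E).
  rewrite length_combine, Hlen, Nat.min_id in Hi.
  rewrite combine_nth in E by auto; injection E as <- <-.
  exists i; auto.
Qed.

(** The pendants at [v] correspond to its neighbours in [W], so together with the neighbours in [S]
    they make up the degree of [v]. *)
Lemma admissible_all (D : nat) (eps K : R) (W L S : list nat) :
  max_degree_le n adj D ->
  (forall u v, adj u v = true -> ok_weight eps K (w u v)) ->
  length L = length W -> Permutation (W ++ S) (seq 0 n) ->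
  admissible D eps K adj S (all_pendants W L S).
Proof.
  intros Hdeg Hw Hlen Hp.
  assert (HdS : NoDup (W ++ S)) by (apply Permutation_NoDup with (seq 0 n);
    [now apply Permutation_sym|apply seq_NoDup]).
  apply NoDup_app_remove_l in HdS; repeat split; [assumption| |].
  - intros p H; apply in_all_pendants in H as (x & _ & _ & Ha & ->); auto.
  - intros v Hv; rewrite pendants_at_all by assumption.
    rewrite Nat.add_comm, <- length_app, <- filter_app, (filter_perm_length _ _ _ Hp).
    apply (Hdeg v).
    assert (In v (seq 0 n)) as Hv'
      by (apply Permutation_in with (W ++ S); [assumption|apply in_or_app; now right]).
    apply in_seq in Hv'; lia.
Qed.

End Link.

(** * The three statements for restricted partition functions *)

Lemma length_filter_neq0 {A : Type} (f : A -> bool) (l : list A) :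
  length (filter f l) <> 0%nat -> exists x, In x l /\ f x = true.
Proof.
  intros H; destruct (filter f l) as [|x m] eqn:E; [now elim H|].
  exists x; apply filter_In; rewrite E; now left.
Qed.

Theorem theorem3p1 (D k : nat) (eps K : R) :
  (3 <= D)%nat -> (D < k)%nat -> 0 < eps < 1 ->
  0 < K < 1 / (INR D - 1) ->
  0 < asin K < PI / (3 * (INR D - 1 + eps)) ->
  (forall d : nat, (d <= D - 1)%nat ->
     let b := INR (D - d) in
     0 < (1 + eps) ^ 2 / ((INR k - b) * (1 - K) ^ d - eps * b) /\
     (1 + eps) ^ 2 / ((INR k - b) * (1 - K) ^ d - eps * b) <= K) ->
  let theta := asin K in
  forall (n : nat) (adj : nat -> nat -> bool) (w : nat -> nat -> Cx),
  simple_graph n adj -> max_degree_le n adj D ->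
  (forall u v, w u v = w v u) ->
  (forall u v, adj u v = true ->
     Cnorm (w u v) <= eps \/
     (abs_arg (w u v) <= eps * theta /\ eps < Cnorm (w u v) <= 1)) ->
  (* (A) *)
  (forall W L : list nat,
     NoDup W -> leaf_independent n adj W ->
     colour_list k L -> length L = length W ->
     Zpart k n adj w W L <> Czero) /\
  (* (B) *)
  (forall (W' L' : list nat) (u l l' : nat),
     NoDup (W' ++ [u]) -> leaf_independent n adj (W' ++ [u]) ->
     colour_list k L' -> length L' = length W' ->
     (1 <= l <= k)%nat -> (1 <= l' <= k)%nat ->
     Cangle (Zpart k n adj w (W' ++ [u]) (L' ++ [l])) (Zpart k n adj w (W' ++ [u]) (L' ++ [l'])) <= theta /\
     in_ball Cone K (Cdiv (Zpart k n adj w (W' ++ [u]) (L' ++ [l])) (Zpart k n adj w (W' ++ [u]) (L' ++ [l'])))) /\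
  (* (Cx) *)
  (forall (W' L' : list nat) (u : nat),
     (u < n)%nat -> NoDup (W' ++ [u]) -> leaf_independent n adj W' ->
     colour_list k L' -> length L' = length W' ->
     let d := free_degree n adj W' u in
     let b := INR (D - d) in
     let GN := fun l => (1 <= l <= k)%nat /\
                 (good_colour adj W' L' u l \/ neutral_colour eps adj w W' L' u l) in
     (forall l, GN l -> Zpart k n adj w (W' ++ [u]) (L' ++ [l]) <> Czero) /\
     (forall l l', GN l -> GN l' ->
        Cangle (Zpart k n adj w (W' ++ [u]) (L' ++ [l])) (Zpart k n adj w (W' ++ [u]) (L' ++ [l']))
          <= (INR d + b * eps) * theta) /\
     (forall l j, (1 <= l <= k)%nat -> (1 <= j <= k)%nat ->
        good_colour adj W' L' u l -> good_colour adj W' L' u j ->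
        in_ball_pow Cone K d
          (Cdiv (Zpart k n adj w (W' ++ [u]) (L' ++ [l])) (Zpart k n adj w (W' ++ [u]) (L' ++ [j]))))).
Proof.
  intros HD Hk Heps HK Htheta Hcond theta n adj w Hg Hdeg Hw Hwt.
  pose proof Hg as (adj_sym & adj_irrefl & adj_lt).
  assert (HK1 : 0 < K < 1) by (pose proof (K_lt_half D K HD HK); lra).
  assert (Hok : forall u v, adj u v = true -> ok_weight eps K (w u v)).
  { intros u v H; destruct (Hwt u v H) as [H1|[H1 H2]]; [now left|right; split; [|lra]].
    apply abs_arg_sector; [|assumption].
    intros E; rewrite E, Cnorm_zero in H2; lra. }
  pose proof (zero_freeness D k eps K HD HK Hk Heps Htheta Hcond adj w adj_sym adj_irrefl Hw Hok)
    as Hzf.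
  split; [|split].
  - intros W L Hd [HW1 HW2] HL Hlen.
    assert (Hp : Permutation (W ++ rest n W) (seq 0 n))
      by (apply perm_rest; [assumption|]; intros x Hx; now apply HW1).
    rewrite (Zpart_free k n adj w Hg Hw W L (rest n W)) by assumption.
    apply (Hzf (rest n W)); now apply (admissible_all n).
  - intros W L u l l' Hd [HW1 HW2] HL Hlen Hl Hl'.
    set (S := rest n (W ++ [u])).
    assert (Hp : Permutation ((W ++ [u]) ++ S) (seq 0 n))
      by (apply perm_rest; [assumption|]; intros x Hx; now apply HW1).
    assert (HuW : In u (W ++ [u])) by (apply in_or_app; right; now left).
    (* [u] has exactly one neighbour, and independence puts it outside [W]. The colour of [u] is
       thus that of a single pendant, and (B) is an instance of [recolourable]. *)
    assert (Hv : exists v, filter (adj u) S = [v]).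
    { destruct (HW1 u HuW) as [_ Hu1]; unfold degree, neighbours in Hu1.
      rewrite <- (filter_perm_length _ _ _ Hp), filter_app in Hu1.
      change (fun v => adj u v) with (adj u) in Hu1.
      assert (E : filter (adj u) (W ++ [u]) = []).
      { assert (Hno : forall x, In x (W ++ [u]) -> adj u x = false) by (intros; now apply HW2).
        clear -Hno; induction (W ++ [u]) as [|x m IH]; [reflexivity|]; simpl.
        rewrite Hno by (now left); apply IH; intros y Hy; apply Hno; now right. }
      rewrite E in Hu1; simpl in Hu1.
      destruct (filter (adj u) S) as [|v [|v' m]]; try discriminate; now exists v. }
    destruct Hv as [v Hv].
    assert (HvS : In v S) by (apply (filter_In (adj u) v S); rewrite Hv; now left).
    assert (HP : forall c, all_pendants adj w (W ++ [u]) (L ++ [c]) S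
      = all_pendants adj w W L S ++ [(v, (w u v, c))]).
    { intros c; unfold all_pendants; rewrite combine_snoc by assumption.
      rewrite flat_map_app; simpl; unfold pendants_of at 2; now rewrite Hv. }
    assert (HLc : forall c, (1 <= c <= k)%nat -> colour_list k (L ++ [c])).
    { intros c Hc; apply Forall_app; split; [assumption|now constructor]. }
    assert (Hlenc : forall c : nat, length (L ++ [c]) = length (W ++ [u])).
    { intros c; rewrite !length_app; simpl; lia. }
    assert (Hadm : forall c, admissible D eps K adj S (all_pendants adj w (W ++ [u]) (L ++ [c]) S))
      by (intros c; now apply (admissible_all n)).
    rewrite !(Zpart_free k n adj w Hg Hw (W ++ [u]) _ S) by auto.
    destruct (Hzf S) as [HA HB].
    pose proof (HA _ (Hadm l')) as Hne.
    pose proof (HB (all_pendants adj w W L S) [] v (w u v) l l' HvS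
      ltac:(apply in_seq; lia) ltac:(apply in_seq; lia)) as Hlt.
    rewrite <- !HP in Hlt; specialize (Hlt (Hadm l)).
    set (z := Zact _ _ _ _ (act_of (all_pendants adj w (W ++ [u]) (L ++ [l]) S))) in *.
    set (z' := Zact _ _ _ _ (act_of (all_pendants adj w (W ++ [u]) (L ++ [l']) S))) in *.
    assert (Hball : in_ball Cone K (Cdiv z z')).
    { unfold in_ball; pose proof (Cnorm_pos _ Hne) as Hpos.
      apply Rmult_lt_reg_r with (Cnorm z'); [assumption|]; rewrite <- Cnorm_mul.
      replace (Cmul (Csub (Cdiv z z') Cone) z') with (Csub z z'); [assumption|].
      rewrite (Cdiv_mul z z' Hne) at 1; ring. }
    split; [|assumption].
    rewrite (Cdiv_mul z z' Hne) at 1.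
    apply Cangle_le_sector; [assumption|now apply ball_sector].
  - intros W L u Hun Hd [HW1 HW2] HL Hlen d b GN.
    set (S := rest n (W ++ [u])).
    assert (Hp : Permutation (W ++ u :: S) (seq 0 n)).
    { change (u :: S) with ([u] ++ S); rewrite app_assoc; apply perm_rest; [assumption|].
      intros x Hx; apply in_app_or in Hx as [Hx|[<-|[]]]; [now apply HW1|assumption]. }
    set (P := all_pendants adj w W L (u :: S)).
    assert (Hadm : admissible D eps K adj (u :: S) P) by (now apply (admissible_all n)).
    destruct (Hzf S) as [HA HB].
    set (Y := fun c => Zact k adj w S (act_of (pendants_of adj w u c S ++ P))).
    assert (HZ : forall c, (1 <= c <= k)%nat ->
      Zpart k n adj w (W ++ [u]) (L ++ [c]) = Cmul (act_of P u c) (Y c))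
      by (intros c Hc; now apply Zpart_pinned).
    assert (HY : forall c, Y c <> Czero)
      by (intros c; now apply HA, admissible_pin).
    assert (HR : forall c c', (1 <= c <= k)%nat -> (1 <= c' <= k)%nat ->
      ball_ratio K d (Y c) (Y c')).
    { intros c c' Hc Hc'; unfold d; rewrite (free_degree_rest n adj Hg).
      apply (recolour_neighbours D k eps K adj w adj_sym Hok S u c c' P HA HB);
        try assumption; apply in_seq; lia. }
    assert (Hcount : (pendants_at P u + d <= D)%nat).
    { destruct Hadm as (_ & _ & Hdeg'); specialize (Hdeg' u (or_introl eq_refl)).
      simpl in Hdeg'; rewrite adj_irrefl in Hdeg'.
      unfold d; rewrite (free_degree_rest n adj Hg); fold S; lia. }
    assert (HPu : forall p, In p P -> fst p = u -> exists i, (i < length W)%nat /\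
      adj u (nth i W 0%nat) = true /\ nth i L 0%nat = snd (snd p) /\
      fst (snd p) = w u (nth i W 0%nat)).
    { intros p Hp' Hpu; apply in_all_pendants in Hp' as (x & Hx & _ & Ha & Ew).
      apply in_combine_nth in Hx as (i & Hi & Ex & El); [|assumption].
      rewrite Hpu in *; exists i; rewrite Ex, adj_sym, Hw; auto. }
    assert (Hgood : forall c, good_colour adj W L u c -> act_of P u c = Cone).
    { intros c Hc; apply act_of_good, Nat.eq_dne; intros Hne; apply length_filter_neq0 in Hne.
      destruct Hne as (p & Hpin & Hpb).
      apply andb_true_iff in Hpb as [E1 E2]; apply Nat.eqb_eq in E1, E2.
      destruct (HPu p Hpin E1) as (i & Hi & Ha & El & _).
      apply Hc; exists i; repeat split; auto; congruence. }
    (* A pendant of colour [c] at [u] rules out that [c] is good. If [c] is neutral, no such pendant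
       has a small weight, so each of them obeys the bound on the argument. *)
    assert (Hsec : forall c, GN c ->
      sector (INR (pendants_col P u c) * (eps * asin K)) (act_of P u c)).
    { intros c [_ Hc]; apply act_of_sector.
      intros p Hpin Hpu Hpc.
      destruct (HPu p Hpin Hpu) as (i & Hi & Ha & El & Ew); rewrite Ew.
      destruct Hc as [Hc|[_ Hc]].
      - elim Hc; exists i; repeat split; auto; congruence.
      - destruct (Hok _ _ Ha) as [Hs|[Hs _]]; [|assumption].
        elim Hc; exists i; repeat split; auto; congruence. }
    split; [|split].
    + intros c Hc; rewrite HZ by apply Hc.
      apply Cmul_neq0; [|apply HY]; eapply sector_neq0, Hsec, Hc.
    + intros c c' Hc Hc'; pose proof (proj1 Hc) as Hcr; pose proof (proj1 Hc') as Hcr'.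
      rewrite !HZ by assumption.
      assert (Hne : Cmul (act_of P u c') (Y c') <> Czero)
        by (apply Cmul_neq0; [eapply sector_neq0, Hsec, Hc'|apply HY]).
      assert (Hb : INR (D - d) = INR D - INR d) by (apply minus_INR; lia).
      assert (0 <= b) by apply pos_INR.
      assert (0 <= INR d) by apply pos_INR.
      (* Equal colours are set apart: the count of pendants in two colours is bounded by [D - d]
         only if the colours differ, as otherwise each pendant is counted twice. *)
      destruct (Nat.eq_dec c c') as [->|Hcc].
      * replace (Cmul (act_of P u c') (Y c')) with (Cmul Cone (Cmul (act_of P u c') (Y c'))) at 1
          by ring.
        apply Cangle_le_sector; [assumption|]; apply sector_one.
        apply Rmult_le_pos; [nra|unfold theta; lra].
      * destruct (sector_quotient _ _ _ _ (Hsec c Hc) (Hsec c' Hc')) as (q & Hq & Eq).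
        destruct (ball_ratio_sector D K HD HK _ _ _ (HR c c' Hcr Hcr')) as (q' & Hq' & Eq').
        replace (Cmul (act_of P u c) (Y c))
          with (Cmul (Cmul q q') (Cmul (act_of P u c') (Y c'))) by (rewrite Eq, Eq'; ring).
        apply Cangle_le_sector; [assumption|].
        eapply sector_le; [|apply sector_mul; [apply Hq|apply Hq']].
        pose proof (pendants_col_pair P u c c' Hcc) as Hpair.
        assert (Hle : (pendants_col P u c + pendants_col P u c' <= D - d)%nat) by lia.
        apply le_INR in Hle; rewrite plus_INR in Hle; fold b in Hle.
        assert (0 <= eps * asin K) by (apply Rmult_le_pos; lra).
        apply (Rmult_le_compat_r (eps * asin K)) in Hle; [|assumption].
        unfold theta; lra.
    + intros c c' Hc Hc' Gc Gc'; rewrite !HZ, !Hgood by assumption.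
      destruct (HR c c' Hc Hc') as (zs & Hlz & Hbz & E).
      exists zs; repeat split; auto.
      apply Cdiv_eq; [apply Cmul_neq0; [|apply HY]|rewrite E; ring].
      intros E1; injection E1; lra.
Qed.
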